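(* The algebra $\mathcal{T}$ is an $\mathfrak{sl}_2$-algebra with respect to the action of $\mathfrak{sl}_2$ on $\mathcal{T}$ given by the derivations $D,W,\mathfrak{d}$ defined below. Moreover, the $q$-bracket $\mathcal{T}\to\widetilde{M}$ is an equivariant map of $\mathfrak{sl}_2$-algebras, i.e., for $f\in\mathcal{T}$ one has \[D\langle f\rangle_q=\langle Df\rangle_q,\quad W\langle f\rangle_q=\langle Wf\rangle_q,\quad \mathfrak{d}\langle f\rangle_q=\langle \mathfrak{d}f\rangle_q.\]
   Context: $\mathscr{P}$ is the set of partitions, $r_m(\lambda)$ the number of parts of $\lambda$ equal to $m$, and $\langle f\rangle_q=\sum_\lambda f(\lambda)q^{|\lambda|}/\sum_\lambda q^{|\lambda|}$. The Faulhaber polynomial $F_l$ is the polynomial with zero constant term with $F_l(n)=\sum_{i=1}^n i^{l-1}$ for $n\ge1$. For $k\ge0,l\ge1$, $k+l$ even, $T_{k,l}(\lambda)=-\frac{B_{k+l}}{2(k+l)}(\delta_{l,1}+\delta_{k,0})+\sum_{m\ge1}m^kF_l(r_m(\lambda))$; by convention $T_{0,0}\equiv T_{-1,1}\equiv-1$ and $T_{k,l}\equiv0$ for other $(k,l)$ with $k<0$ or $l<1$. $\mathcal{T}$ is the algebra generated by the $T_{k,l}$ under pointwise product; the elements $T_{k_1,l_1}\odot\cdots\odot T_{k_n,l_n}$ form a basis of it, where $\odot$ is the induced product ($\langle f\odot g\rangle_{\vec u}=\langle f\rangle_{\vec u}\langle g\rangle_{\vec u}$ with $\langle f\rangle_{\vec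 u}=\sum_\lambda f(\lambda)u_{\lambda_1}u_{\lambda_2}\cdots/\sum_\lambda u_{\lambda_1}u_{\lambda_2}\cdots$), and $\langle f\odot g\rangle_q=\langle f\rangle_q\langle g\rangle_q$. On $\mathcal{T}$ define derivations by $D\,T_{k,l}=T_{k+1,l+1}$, $W\,T_{k,l}=(k+l)T_{k,l}$, $\mathfrak{d}\,T_{k,l}=k(l-1)T_{k-1,l-1}-\tfrac12\delta_{k+l-2}$ (where $\delta_{k+l-2}$ is $1$ if $k+l=2$ and $0$ otherwise); these satisfy $[W,D]=2D$, $[W,\mathfrak{d}]=-2\mathfrak{d}$, $[\mathfrak{d},D]=W$. On the algebra $\widetilde{M}$ of quasimodular forms, $D=q\,\frac{d}{dq}$, $W$ multiplies by the weight, and $\mathfrak{d}$ is the derivation annihilating modular forms with $\mathfrak{d}G_2=-\tfrac12$ (equivalently $\phi\mapsto 2\pi i\phi_1$ in the quasimodular transformation law). An $\mathfrak{g}$-algebra is an algebra with a Lie homomorphism $\mathfrak{g}\to\mathrm{Der}(A)$. *)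

(* Defs.v *)
From HB Require Import structures.
From mathcomp Require Import all_boot all_order all_algebra.
From mathcomp Require Import mpoly.
Set Implicit Arguments. Unset Strict Implicit. Unset Printing Implicit Defensive.
Import Order.TTheory GRing.Theory Num.Theory.
Local Open Scope ring_scope.

(* Partitions, encoded by their multiplicity vectors:                 *)
(*   r`_i = r_{i+1}(lambda) = number of parts equal to i+1,           *)
(* with no trailing zeros (canonical form).                           *)
Fixpoint strip0 (r : seq nat) : seq nat :=
  match r with
  | [::] => [::]
  | x :: r' => let t := strip0 r' in
               if (t == [::]) && (x == 0%N) then [::] else x :: t
  end.

Lemma strip0_ok (r : seq nat) : last 1%N (strip0 r) != 0%N.
Proof.
elim: r => [|x r IH] //=.
case: (strip0 r) IH => [|y t] IH /=; first by case: x.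
by [].
Qed.

Definition intpart := {r : seq nat | last 1%N r != 0%N}.
Definition mkpart (r : seq nat) : intpart := exist _ (strip0 r) (strip0_ok r).

Definition mult (la : intpart) (m : nat) : nat :=
  if m is m'.+1 then nth 0%N (proj1_sig la) m' else 0%N.

Definition wt (r : seq nat) : nat := \sum_(i < size r) (i.+1 * nth 0%N r i)%N.

Fixpoint boxes (r : seq nat) : seq (seq nat) :=
  match r with
  | [::] => [:: [::]]
  | x :: r' => [seq i :: a | i <- iota 0 x.+1, a <- boxes r']
  end.

Definition vsub (a b : seq nat) : seq nat :=
  mkseq (fun i => (nth 0%N a i - nth 0%N b i)%N) (maxn (size a) (size b)).

(* The induced product f (.) g, characterized by <f (.) g>_u =        *)
(* <f>_u <g>_u.  Writing u_lambda = prod_m u_m^{r_m} and              *)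
(* sum_lambda u_lambda = prod_m (1-u_m)^{-1}, this amounts to          *)
(*   sum (f(.)g)(l) u_l = (sum f(l)u_l)(sum g(l)u_l) prod_m (1-u_m),  *)
(* i.e. coefficientwise the formula below.                            *)
Definition odot (f g : intpart -> rat) : intpart -> rat := fun la =>
  let r := proj1_sig la in
  \sum_(s <- boxes (map (minn 1) r))
    \sum_(a <- boxes (vsub r s))
      (-1) ^+ (sumn s) * f (mkpart a) * g (mkpart (vsub (vsub r s) a)).

Definition one_fn : intpart -> rat := fun _ => 1.

Fixpoint bernl (n : nat) : seq rat :=
  match n with
  | 0%N => [:: 1]
  | n'.+1 => let l := bernl n' in
             rcons l (- (\sum_(j < n'.+1) ('C(n'.+2, j))%:R * l`_j) / (n'.+2)%:R)
  end.
Definition bern (n : nat) : rat := (bernl n)`_n.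

(* Faulhaber: F_l(n) = sum_{i=1}^n i^(l-1)  (only evaluated at n >= 0) *)
Definition faulhaber (l n : nat) : rat := \sum_(1 <= i < n.+1) (i%:R) ^+ l.-1.

Definition Tkl (k l : nat) : intpart -> rat :=
  if (0 < l)%N && ~~ odd (k + l) then
    fun la => - bern (k + l) / (2 * (k + l))%:R * ((l == 1%N) + (k == 0%N))%:R
              + \sum_(i < size (proj1_sig la))
                  (i.+1)%:R ^+ k * faulhaber l (nth 0%N (proj1_sig la) i)
  else fun _ => 0.

(* Elements of T via the basis T_{k1,l1} (.) ... (.) T_{kn,ln}:        *)
(* formal Q-linear combinations of (.)-monomials in the generators.    *)
Definition fmon := seq (nat * nat).
Definition felt := seq (rat * fmon).

Definition evmon (m : fmon) : intpart -> rat :=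
  foldr odot one_fn [seq Tkl kl.1 kl.2 | kl <- m].
Definition ev (p : felt) : intpart -> rat :=
  fun la => \sum_(t <- p) t.1 * evmon t.2 la.

Definition validf (p : felt) : bool :=
  all (fun t => all (fun kl => (0 < kl.2)%N && ~~ odd (kl.1 + kl.2)) t.2) p.

(* the (.)-derivation determined by its values img(k,l) on generators *)
Definition derf (img : nat * nat -> felt) (p : felt) : felt :=
  flatten [seq flatten [seq [seq (t.1 * u.1, take i t.2 ++ u.2 ++ drop i.+1 t.2)
                                | u <- img (nth (0%N, 0%N) t.2 i)]
                        | i <- iota 0 (size t.2)]
          | t <- p].

Definition imgD (kl : nat * nat) : felt := [:: (1, [:: (kl.1.+1, kl.2.+1)])].
Definition imgW (kl : nat * nat) : felt := [:: ((kl.1 + kl.2)%:R, [:: kl])].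
(* d T_{k,l} = k(l-1) T_{k-1,l-1} - 1/2 delta_{k+l,2}
   (the term k(l-1)T_{k-1,l-1} vanishes unless k >= 1, l >= 2) *)
Definition imgd (kl : nat * nat) : felt :=
  (if (0 < kl.1)%N && (1 < kl.2)%N
   then [:: ((kl.1 * kl.2.-1)%:R, [:: (kl.1.-1, kl.2.-1)])] else [::])
  ++ (if (kl.1 + kl.2 == 2)%N then [:: (- (1 / 2), [::])] else [::]).

Definition Dop := derf imgD.
Definition Wop := derf imgW.
Definition dop := derf imgd.

Definition series := nat -> rat.

Definition smul (a b : series) : series := fun n => \sum_(i < n.+1) a i * b (n - i)%N.

(* formal inverse of a series with nonzero constant term *)
Fixpoint sinvl (s : series) (n : nat) : seq rat :=
  match n with
  | 0%N => [:: (s 0%N)^-1]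
  | n'.+1 => let l := sinvl s n' in
             rcons l (- (\sum_(k < n'.+1) s k.+1 * l`_(n' - k)) / s 0%N)
  end.
Definition sinv (s : series) : series := fun n => (sinvl s n)`_n.

Definition qnum (f : intpart -> rat) : series := fun n =>
  \sum_(r <- boxes [seq (n %/ i.+1)%N | i <- iota 0 n] | wt r == n) f (mkpart r).

Definition qbracket (f : intpart -> rat) : series :=
  smul (qnum f) (sinv (qnum one_fn)).

Definition Dser (s : series) : series := fun n => n%:R * s n.

Definition Gser (j : 'I_3) : series := fun n =>
  let k := (2 * j.+1)%N in
  if n == 0%N then - bern k / (2 * k)%:R
  else (\sum_(d <- divisors n) d ^ k.-1)%:R.

(* quasimodular forms: M~ = Q[G2, G4, G6]; value of P(G2,G4,G6) as a
   q-series (coefficient n computed from the truncations mod q^(n+1)) *)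
Definition eval_qm (P : {mpoly rat[3]}) : series := fun n =>
  (mmap (@polyC rat) (fun j : 'I_3 => \poly_(i < n.+1) Gser j i) P)`_n.

(* W on M~: multiplication by the weight (G_{2(j+1)} has weight 2(j+1)) *)
Definition Wqm (P : {mpoly rat[3]}) : {mpoly rat[3]} :=
  \sum_(j < 3) (2 * j.+1)%:R *: ('X_j * mderiv j P).
(* d on M~: annihilates modular forms Q[G4,G6], d G2 = -1/2 *)
Definition dqm (P : {mpoly rat[3]}) : {mpoly rat[3]} :=
  (- (1 / 2)) *: mderiv (0 : 'I_3) P.

(* Main.v *)
Require Import Defs.
From mathcomp Require Import all_boot all_order all_algebra.
From mathcomp Require Import mpoly.
From mathcomp Require Import zify ring lra.
Set Implicit Arguments. Unset Strict Implicit. Unset Printing Implicit Defensive.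
Import GRing.Theory Num.Theory.
Local Open Scope ring_scope.

(* The sl_2-relations hold already for derivations of the free associative
   algebra on the generators, so they only have to be checked there.

   For the q-bracket: the induced product is, up to the normalizing factor,
   multiplication of generating functions, so <f (.) g>_q = <f>_q <g>_q, and
   <T_{k,l}>_q = const + sum_{m,r} m^k r^(l-1) q^(mr), which is the
   min(k,l-1)-st derivative of G_{|k-l+1|+1}.  It remains to know that
   Q[G_2,G_4,G_6] is closed under q d/dq (Ramanujan) and contains all G_{2m},
   compatibly with weight and with d.  Everything follows from
     sum_{i+j=2m, i,j odd} binom(2m,i) G_{i+1} G_{j+1}
        = (2m+3)/(2(2m+1)) G_{2m+2} - q d/dq G_{2m}
   and G_8 = 120 G_4^2.  Both come from one elementary identity of Liouville
   type: if h and k are symmetric and k(a+b,b) = h(a,b), then over the positive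
   solutions of ax+by = n the sum of h(a,b) - k(a,b) reduces to the diagonals
   x = y and a = b. *)

(** * Derivations of the free algebra *)

(** W and d are defined on polynomials in G_2, G_4, G_6, not coefficientwise on q-series, and one
    polynomial has to serve W and d at once. The bracket is therefore lifted to polynomials: each
    generator gets an explicit [Tpoly k l], words get products, and equivariance becomes a
    comparison of derivations on generators, with evaluation at q-series as the only analytic input.
    The delicate operator is d. It must kill G_(2m) for m at least 2, although the recurrence
    producing G_(2m) involves D and the non-modular G_2; this is forced by [d, D] = W. The same
    commutator yields d D^(a+1) G = (a+1)(w+a) D^a G for an Eisenstein series G of weight w, and
    this is where the coefficient k(l-1) in d T_(k,l) comes from. *)

Definition validm (m : fmon) : bool :=
  all (fun kl => (0 < kl.2)%N && ~~ odd (kl.1 + kl.2)) m.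

Section FormalDerivations.
Variable V : lmodType rat.
Implicit Types (phi : fmon -> V) (p : felt) (m : fmon) (img : nat * nat -> felt).

(** Formal combinations are lists of terms without a normal form, so identities between them are
    stated after applying an arbitrary linear functional. *)
Definition lin phi p : V := \sum_(t <- p) t.1 *: phi t.2.

(** The transpose of a derivation: the Leibniz rule on the word [m], tested by [phi]. Compositions
    of derivations therefore appear in reversed order. *)
Definition dmon img m phi : V :=
  \sum_(0 <= i < size m)
    lin (fun u => phi (take i m ++ u ++ drop i.+1 m)) (img (nth (0, 0)%N m i)).

Lemma eq_lin phi psi p : phi =1 psi -> lin phi p = lin psi p.
Proof. by move=> e; apply: eq_bigr => t _; rewrite e. Qed.

Lemma lin_cat phi p1 p2 : lin phi (p1 ++ p2) = lin phi p1 + lin phi p2.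
Proof. by rewrite /lin big_cat. Qed.

Lemma linD phi psi p : lin (fun m => phi m + psi m) p = lin phi p + lin psi p.
Proof. by rewrite -big_split; apply: eq_bigr => t _; rewrite scalerDr. Qed.

Lemma lin_sum (I : Type) (r : seq I) (phi : I -> fmon -> V) p :
  lin (fun m => \sum_(i <- r) phi i m) p = \sum_(i <- r) lin (phi i) p.
Proof. by rewrite /lin exchange_big; apply: eq_bigr => t _; rewrite scaler_sumr. Qed.

Lemma linZ c phi p : lin (fun m => c *: phi m) p = c *: lin phi p.
Proof. by rewrite scaler_sumr; apply: eq_bigr => t _; rewrite !scalerA mulrC. Qed.

Lemma lin_derf img phi p : lin phi (derf img p) = lin (fun m => dmon img m phi) p.
Proof.
rewrite /lin /derf big_flatten big_map; apply: eq_bigr => t _.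
rewrite big_flatten big_map /dmon /index_iota subn0 scaler_sumr.
apply: eq_bigr => i _; rewrite big_map scaler_sumr.
by apply: eq_bigr => u _; rewrite scalerA.
Qed.

Lemma eq_dmon img m phi psi : phi =1 psi -> dmon img m phi = dmon img m psi.
Proof. by move=> e; apply: eq_bigr => i _; apply: eq_lin => u; rewrite e. Qed.

Lemma dmon_nil img phi : dmon img [::] phi = 0.
Proof. by rewrite /dmon big_nil. Qed.

Lemma dmon_cons img x m phi :
  dmon img (x :: m) phi =
    lin (fun u => phi (u ++ m)) (img x) + dmon img m (fun m' => phi (x :: m')).
Proof. by rewrite /dmon big_nat_recl //= drop0. Qed.

Lemma dmon_cat img m1 m2 phi :
  dmon img (m1 ++ m2) phi =
    dmon img m1 (fun m => phi (m ++ m2)) + dmon img m2 (fun m => phi (m1 ++ m)).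
Proof.
elim: m1 phi => [|x m1 IH] phi /=; first by rewrite dmon_nil add0r.
rewrite !dmon_cons IH addrA; congr (_ + _ + _).
by apply: eq_lin => u; rewrite catA.
Qed.

Lemma dmonD img m phi psi :
  dmon img m (fun m' => phi m' + psi m') = dmon img m phi + dmon img m psi.
Proof. by rewrite -big_split; apply: eq_bigr => i _; rewrite linD. Qed.

Lemma dmon_lin img m (phi : fmon -> fmon -> V) p :
  dmon img m (fun m' => lin (phi^~ m') p) = lin (fun u => dmon img m (phi u)) p.
Proof.
rewrite /dmon lin_sum; apply: eq_bigr => i _; rewrite /lin.
under eq_bigr do rewrite scaler_sumr.
rewrite exchange_big; apply: eq_bigr => t _; rewrite scaler_sumr.
by apply: eq_bigr => u _; rewrite !scalerA mulrC.
Qed.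

Lemma cancel_cross (a b d e a' e' : V) :
  a + b + (d + e) - (a' + d + (b + e')) = a - a' + (e - e').
Proof.
have K (x y z : V) : x + z - (y + z) = x - y by rewrite opprD addrACA subrr addr0.
by rewrite [a + b + _]addrACA opprD [LHS]addrACA K [b + e]addrC [b + e']addrC K.
Qed.

(** The commutator of two derivations is again a derivation, hence determined on letters: the terms
    in which they act on different letters occur in both orders and cancel ([cancel_cross]). *)
Lemma dmon_commutator img1 img2 img3 c m phi :
  validm m ->
  (forall x psi, (0 < x.2)%N -> ~~ odd (x.1 + x.2) ->
     lin psi (derf img1 (img2 x)) - lin psi (derf img2 (img1 x))
       = c *: lin psi (img3 x)) ->
  dmon img2 m (fun m' => dmon img1 m' phi) - dmon img1 m (fun m' => dmon img2 m' phi)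
    = c *: dmon img3 m phi.
Proof.
move=> + H; elim: m phi => [|x m IH] phi /=.
  by rewrite !dmon_nil subr0 scaler0.
case/andP=> /andP[x2 ox] vm.
have aux i1 i2 : dmon i2 (x :: m) (fun m' => dmon i1 m' phi) =
   lin (fun u => phi (u ++ m)) (derf i1 (i2 x))
   + lin (fun u => dmon i1 m (fun m' => phi (u ++ m'))) (i2 x)
   + (lin (fun u => dmon i2 m (fun m' => phi (u ++ m'))) (i1 x)
   + dmon i2 m (fun m' => dmon i1 m' (fun m'' => phi (x :: m'')))).
  rewrite dmon_cons; congr (_ + _).
    by rewrite lin_derf -linD; apply: eq_lin => u; rewrite dmon_cat.
  by rewrite -dmon_lin -dmonD; apply: eq_dmon => m'; rewrite dmon_cons.
rewrite !aux dmon_cons scalerDr -(H x) // -IH //.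
exact: cancel_cross.
Qed.

End FormalDerivations.

Lemma ev_lin p la : ev p la = lin (V := rat^o) (evmon^~ la) p.
Proof. by []. Qed.

Lemma lin_derf_commutator img1 img2 img3 (c : rat) (phi : fmon -> rat^o) p :
  validf p ->
  (forall x psi, (0 < x.2)%N -> ~~ odd (x.1 + x.2) ->
     lin (V := rat^o) psi (derf img1 (img2 x)) - lin psi (derf img2 (img1 x))
       = c *: lin psi (img3 x)) ->
  lin phi (derf img1 (derf img2 p)) - lin phi (derf img2 (derf img1 p))
    = c *: lin phi (derf img3 p).
Proof.
move=> vp H; rewrite !lin_derf -linZ /lin -sumrB big_seq [RHS]big_seq.
apply: eq_bigr => t tp; rewrite -scalerBr.
by rewrite (dmon_commutator _ (allP vp _ tp) H).
Qed.

Lemma lin1 (V : lmodType rat) (phi : fmon -> V) t : lin phi [:: t] = t.1 *: phi t.2.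
Proof. exact: big_seq1. Qed.

(** On a generator, [d, D] = W amounts to (k+1)l - k(l-1) = k+l. The constant -1/2 occurs only for
    k+l = 2; since W kills constants, it picks up the factor -2 in [W, d]. *)
Lemma sl2_formal p (phi : fmon -> rat^o) : validf p ->
  [/\ lin phi (Wop (Dop p)) - lin phi (Dop (Wop p)) = 2 *: lin phi (Dop p),
      lin phi (Wop (dop p)) - lin phi (dop (Wop p)) = - 2 *: lin phi (dop p) &
      lin phi (dop (Dop p)) - lin phi (Dop (dop p)) = 1 *: lin phi (Wop p)].
Proof.
move=> vp; split; apply: lin_derf_commutator => // -[k l] psi /= l0 okl.
- rewrite /derf /lin /imgD /imgW /= !big_seq1 /= /GRing.scale /=.
  by rewrite addnS addSn; ring.
- rewrite /derf /lin /imgd /imgW /=.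
  (* The boundary values k = 0 and l = 1, where the term T_(k-1,l-1) is absent, are separated. *)
  case: k l l0 okl => [|k] [|[|l]] //= _ okl.
  all: try (case: ifP => e).
  all: rewrite /= ?big_cons ?big_nil /= /GRing.scale /=.
  all: rewrite ?mulr0 ?mul1r.
  all: try (rewrite (eqP e); ring).
  all: try (by rewrite subr0).
  all: rewrite ?addnS ?addSn; try by exfalso; move: e; rewrite !addnS.
  by ring.
- rewrite /derf /lin /imgd /imgD /imgW /= !addnS !addSn.
  case: k l l0 okl => [|k] [|[|l]] //= _ okl.
  all: try (case: ifP => e).
  all: rewrite /= ?big_cons ?big_nil /= /GRing.scale /=.
  all: rewrite ?addnS ?addn0 ?addn1 ?addSn ?add0n ?mulr0 ?mul1r.
  all: by ring.
Qed.

(** * Truncated power series and partition generating functions *)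

(** Power series are handled as polynomials modulo X^(N+1), for every N. Phrasing the congruence as
    divisibility lets Gauss's lemma cancel factors with nonzero constant term. *)
Definition eqX (N : nat) (p q : {poly rat}) := dvdp ('X^(N.+1)) (p - q).

Lemma eqX_refl N p : eqX N p p.
Proof. by rewrite /eqX subrr dvdp0. Qed.

Lemma eqX_sym N p q : eqX N p q -> eqX N q p.
Proof. by rewrite /eqX -opprB dvdpNr. Qed.

Lemma eqX_trans N q p r : eqX N p q -> eqX N q r -> eqX N p r.
Proof. by move=> h1 h2; rewrite /eqX -(subrK q p) -addrA; apply: dvdp_add. Qed.

Lemma eqXD N p q p' q' : eqX N p q -> eqX N p' q' -> eqX N (p + p') (q + q').
Proof. by move=> h1 h2; rewrite /eqX opprD addrACA; apply: dvdp_add. Qed.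

Lemma eqXM N p q p' q' : eqX N p q -> eqX N p' q' -> eqX N (p * p') (q * q').
Proof.
move=> h1 h2; rewrite /eqX.
have -> : p * p' - q * q' = (p - q) * p' + q * (p' - q') by ring.
by apply: dvdp_add; [exact: dvdp_mulr | exact: dvdp_mull].
Qed.

Lemma eqX_sum N (I : Type) (r : seq I) (P : pred I) F G :
  (forall i, P i -> eqX N (F i) (G i)) ->
  eqX N (\sum_(i <- r | P i) F i) (\sum_(i <- r | P i) G i).
Proof.
move=> h; elim/big_rec2: _ => [|i p q /h hi hpq]; first exact: eqX_refl.
exact: eqXD.
Qed.

Lemma eqX_coefP N (p q : {poly rat}) : reflect (forall i, (i <= N)%N -> p`_i = q`_i) (eqX N p q).
Proof.
rewrite /eqX; apply: (iffP idP) => [/dvdpP[u e] i iN|h].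
  have := congr1 (fun r : {poly rat} => r`_i) e.
  by rewrite coefB coefMXn ltnS iN => /eqP; rewrite subr_eq0 => /eqP.
rewrite -(poly_take_drop N.+1 (p - q)) dvdp_addr ?dvdp_mulIr //.
rewrite (_ : take_poly _ _ = 0) ?dvdp0 //.
apply/polyP => i; rewrite coef_take_poly coef0 coefB; case: ifP => // iN.
by rewrite h // subrr.
Qed.

Lemma eqX_cancel N (z p q : {poly rat}) : z`_0 != 0 -> eqX N (p * z) (q * z) -> eqX N p q.
Proof.
move=> z0; rewrite /eqX -mulrBl Gauss_dvdpl //.
rewrite coprimep_expl // coprimep_sym -['X]subr0 coprimep_XsubC /root.
by rewrite horner_coef0.
Qed.

Definition trunc (N : nat) (s : series) : {poly rat} := \poly_(i < N.+1) s i.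

Lemma coef_trunc N s i : (i <= N)%N -> (trunc N s)`_i = s i.
Proof. by move=> iN; rewrite coef_poly ltnS iN. Qed.

Lemma trunc_smul N s t : eqX N (trunc N (smul s t)) (trunc N s * trunc N t).
Proof.
apply/eqX_coefP => i iN; rewrite coef_trunc // coefM; apply: eq_bigr => j _.
by rewrite !coef_trunc //; have := ltn_ord j; lia.
Qed.

Lemma size_sinvl s n : size (sinvl s n) = n.+1.
Proof. by elim: n => //= n IH; rewrite size_rcons IH. Qed.

Lemma nth_sinvl s n i : (i <= n)%N -> (sinvl s n)`_i = sinv s i.
Proof.
elim: n => [|n IH]; first by rewrite leqn0 => /eqP->.
rewrite leq_eqVlt => /orP[/eqP-> //|iN].
by rewrite /= nth_rcons size_sinvl iN IH.
Qed.

Lemma sinvS s n :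
  sinv s n.+1 = - (\sum_(k < n.+1) s k.+1 * sinv s (n - k)%N) / s 0%N.
Proof.
rewrite {1}/sinv /= nth_rcons size_sinvl ltnn eqxx.
by congr (- _ / _); apply: eq_bigr => k _; rewrite nth_sinvl // leq_subr.
Qed.

Lemma smul_sinv s n : s 0%N != 0 -> smul s (sinv s) n = (n == 0%N)%:R.
Proof.
move=> s0; case: n => [|n]; rewrite /smul big_ord_recl /= ?big_ord0 ?addr0.
  by rewrite mulfV.
rewrite subn0 sinvS mulrCA mulfV // mulr1 addrC; apply/eqP; rewrite subr_eq0.
by apply/eqP/eq_bigr => i _; rewrite /bump /= add1n subSS.
Qed.

(** The first entry counts the parts of size [i+1]; this offset makes induction on multiplicity
    vectors possible. *)
Fixpoint wt_from (i : nat) (r : seq nat) : nat :=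
  if r is x :: r' then (i.+1 * x + wt_from i.+1 r')%N else 0%N.

Lemma wtE r : wt r = wt_from 0 r.
Proof.
suff H i : wt_from i r = \sum_(j < size r) ((i + j).+1 * nth 0%N r j)%N by rewrite H.
elim: r i => [|x r IH] i /=; first by rewrite big_ord0.
by rewrite big_ord_recl IH addn0; congr addn; apply: eq_bigr => j _; rewrite /= addnS.
Qed.

Definition boxgf (i : nat) (B : seq nat) (F : seq nat -> rat) : {poly rat} :=
  \sum_(r <- boxes B) F r *: 'X^(wt_from i r).

Lemma boxgf_nil i F : boxgf i [::] F = (F [::])%:P.
Proof. by rewrite /boxgf big_seq1 /= expr0 alg_polyC. Qed.

Lemma big_boxes_cons (V : nmodType) b B (F : seq nat -> V) :
  \sum_(r <- boxes (b :: B)) F r = \sum_(x < b.+1) \sum_(r <- boxes B) F (nat_of_ord x :: r).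
Proof. by rewrite big_allpairs_dep -(big_mkord xpredT (fun x => \sum_(r <- boxes B) F (x :: r))). Qed.

Lemma boxgf_cons i b B F :
  boxgf i (b :: B) F =
  \sum_(x < b.+1) 'X^(i.+1 * x) * boxgf i.+1 B (fun r => F (nat_of_ord x :: r)).
Proof.
rewrite /boxgf big_boxes_cons; apply: eq_bigr => x _; rewrite mulr_sumr.
by apply: eq_bigr => r _; rewrite /= exprD scalerAr.
Qed.

Lemma eq_boxgf i B F G : F =1 G -> boxgf i B F = boxgf i B G.
Proof. by move=> e; apply: eq_bigr => r _; rewrite e. Qed.

(** A part of size s with multiplicity above N/s contributes only beyond X^N, so all sufficiently
    large boxes agree modulo X^(N+1). *)
Lemma boxgf_bounds N i B B' F : size B = size B' ->
  (forall j, (j < size B)%N -> (N %/ (i + j).+1 <= nth 0%N B j)%N) ->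
  (forall j, (j < size B)%N -> (N %/ (i + j).+1 <= nth 0%N B' j)%N) ->
  eqX N (boxgf i B F) (boxgf i B' F).
Proof.
have one b B1 B2 F1 G1 j : (N %/ j.+1 <= b)%N ->
    (forall x : nat, eqX N (boxgf j.+1 B1 (fun r => F1 (x :: r))) (boxgf j.+1 B2 (fun r => G1 (x :: r)))) ->
  eqX N (boxgf j (b :: B1) F1)
        (\sum_(x < (N %/ j.+1).+1) 'X^(j.+1 * x) * boxgf j.+1 B2 (fun r => G1 (nat_of_ord x :: r))).
  move=> hb hF; rewrite boxgf_cons.
  rewrite -(big_mkord xpredT (fun x => 'X^(j.+1 * x) * boxgf j.+1 B1 (fun r => F1 (x :: r)))).
  rewrite -(big_mkord xpredT (fun x => 'X^(j.+1 * x) * boxgf j.+1 B2 (fun r => G1 (x :: r)))).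
  rewrite (big_cat_nat (n := (N %/ j.+1).+1)) //= -[X in eqX _ _ X]addr0.
  apply: eqXD.
    by apply: eqX_sum => x _; apply: eqXM => //; exact: eqX_refl.
  rewrite big_nat; elim/big_rec: _ => [|x p /andP[hx _] hp]; first exact: eqX_refl.
  rewrite -[0]addr0; apply: eqXD hp.
  rewrite /eqX subr0 dvdp_mulr // dvdp_exp2l //.
  by rewrite ltn_divLR // mulnC in hx.
elim: B B' i F => [|b B IH] [|b' B'] // i F; first by move=> *; exact: eqX_refl.
move=> [sz] h h'.
have hIH x : eqX N (boxgf i.+1 B (fun r => F (x :: r))) (boxgf i.+1 B' (fun r => F (x :: r))).
  by apply: IH => // j jB; rewrite addSnnS; [apply: (h j.+1)|apply: (h' j.+1)].
apply: (eqX_trans (one _ _ B' _ F _ _ hIH)).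
  by have := h 0%N isT; rewrite addn0.
apply: eqX_sym; apply: (one) => [|x]; last exact: eqX_refl.
by have := h' 0%N isT; rewrite addn0.
Qed.

Lemma boxgf_nseq0 i B k F :
  boxgf i (B ++ nseq k 0%N) F = boxgf i B (fun r => F (r ++ nseq k 0%N)).
Proof.
have w0 j : wt_from j (nseq k 0%N) = 0%N by elim: k j => //= k IH j; rewrite muln0 IH.
elim: B i F => [|b B IH] i F /=.
  rewrite boxgf_nil /boxgf.
  have -> : boxes (nseq k 0%N) = [:: nseq k 0%N].
    by elim: {w0} k => //= k ->.
  by rewrite big_seq1 w0 expr0 alg_polyC.
by rewrite !boxgf_cons; apply: eq_bigr => x _; rewrite IH.
Qed.

(** * The induced product *)

Lemma strip0_cat r k : strip0 (r ++ nseq k 0%N) = strip0 r.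
Proof.
have z0 : strip0 (nseq k 0%N) = [::] by elim: k => //= k ->.
by elim: r => //= x r ->.
Qed.

Lemma mkpart_cat0 r k : mkpart (r ++ nseq k 0%N) = mkpart r.
Proof. by apply: val_inj; exact: strip0_cat. Qed.

Lemma strip0K r : exists k, r = strip0 r ++ nseq k 0%N.
Proof.
elim: r => [|x r [k e]] /=; first by exists 0%N.
case: ifP => [/andP[/eqP s0 /eqP ->]|_]; last by exists k; rewrite {1}e.
by exists k.+1; rewrite {1}e s0.
Qed.

Lemma boxes_cat0 B k : boxes (B ++ nseq k 0%N) = [seq r ++ nseq k 0%N | r <- boxes B].
Proof.
elim: B => [|b B IH]; first by elim: k => //= k ->.
have map_allpairs (g : seq nat -> seq nat) s t : map g [seq (i : nat) :: a | i <- s, a <- t]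
   = [seq g (i :: a) | i <- s, a <- t].
  by elim: s => //= i s <-; rewrite map_cat -map_comp.
have boxes_cons b' B' : boxes (b' :: B') = [seq i :: a | i <- iota 0 b'.+1, a <- boxes B'] by [].
rewrite cat_cons !boxes_cons map_allpairs IH.
by elim: (iota 0 b.+1) => //= i s ->; rewrite -map_comp.
Qed.

Lemma size_boxes B r : r \in boxes B -> size r = size B.
Proof.
elim: B r => [|b B IH] r; first by rewrite inE => /eqP ->.
rewrite [boxes _]/([seq (i : nat) :: a | i <- iota 0 b.+1, a <- boxes B]).
by case/allpairsPdep => i [a] [_ /IH sa ->]; rewrite /= sa.
Qed.

Lemma vsub_cons x y r s : vsub (x :: r) (y :: s) = (x - y)%N :: vsub r s.
Proof.
rewrite /vsub /= maxnSS /mkseq /=; congr (_ :: _).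
by rewrite (iotaDl 1 0) -map_comp.
Qed.

Lemma vsub_cat0 r s k : size s = size r ->
  vsub (r ++ nseq k 0%N) (s ++ nseq k 0%N) = vsub r s ++ nseq k 0%N.
Proof.
elim: r s => [|x r IH] [|y s] //; last by case=> /IH e; rewrite !cat_cons !vsub_cons e.
by move=> _; elim: k => // k IHk; rewrite /= vsub_cons IHk.
Qed.

(** The sum of [odot] on vectors that may end in zeros, as boxes produce them and as splitting off
    one coordinate requires. *)
Definition odot_vec (F G : seq nat -> rat) (r : seq nat) : rat :=
  \sum_(s <- boxes (map (minn 1) r))
    \sum_(a <- boxes (vsub r s))
      (-1) ^+ (sumn s) * F a * G (vsub (vsub r s) a).

Lemma odot_mkpart f g r :
  odot f g (mkpart r) = odot_vec (f \o mkpart) (g \o mkpart) r.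
Proof.
have [k {2}->] := strip0K r; rewrite /odot /= /odot_vec.
set t := strip0 r.
have -> : map (minn 1) (t ++ nseq k 0%N) = map (minn 1) t ++ nseq k 0%N.
  by rewrite map_cat map_nseq.
rewrite boxes_cat0 big_map; apply: eq_big_seq => s /size_boxes.
rewrite size_map => sz; rewrite vsub_cat0 // boxes_cat0 big_map.
apply: eq_big_seq => a /size_boxes sa.
rewrite vsub_cat0 //= !mkpart_cat0 sumn_cat sumn_nseq mul0n addn0.
by [].
Qed.

(** A single box, the cube of side N, serves all coefficients up to N. *)
Lemma qnum_boxgf N f n : (n <= N)%N ->
  qnum f n = (boxgf 0 (nseq N N) (f \o mkpart))`_n.
Proof.
move=> nN; set B := [seq (n %/ i.+1)%N | i <- iota 0 n].
have sB : size B = n by rewrite size_map size_iota.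
have hB j : (j < N)%N -> (n %/ j.+1 <= nth 0%N (B ++ nseq (N - n) 0%N) j)%N.
  move=> jN; rewrite nth_cat sB; case: ltnP => jn.
    by rewrite (nth_map 0%N) ?size_iota // nth_iota.
  by rewrite divn_small.
have szB : size (B ++ nseq (N - n) 0%N) = N by rewrite size_cat sB size_nseq subnKC.
have : eqX n (boxgf 0 (B ++ nseq (N - n) 0%N) (f \o mkpart)) (boxgf 0 (nseq N N) (f \o mkpart)).
  apply: boxgf_bounds; rewrite szB ?size_nseq // => j jN.
  by rewrite nth_nseq jN (leq_trans (leq_div _ _)).
move=> /eqX_coefP/(_ _ (leqnn n)) <-.
rewrite boxgf_nseq0 (@eq_boxgf _ _ _ (f \o mkpart)); last by move=> r /=; rewrite mkpart_cat0.
rewrite /boxgf coef_sum /qnum -/B big_mkcond; apply: eq_bigr => r _.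
by rewrite coefZ coefXn -wtE eq_sym; case: eqP; rewrite ?mulr1 ?mulr0.
Qed.

Lemma trunc_qnum N f : eqX N (trunc N (qnum f)) (boxgf 0 (nseq N N) (f \o mkpart)).
Proof. by apply/eqX_coefP => n nN; rewrite coef_trunc // (qnum_boxgf f nN). Qed.

Lemma odot_vec_nil F G : odot_vec F G [::] = F [::] * G [::].
Proof. by rewrite /odot_vec /= !big_seq1 expr0 mul1r. Qed.

(** In one coordinate, [e] comes from the factor 1 - u and [a] from the Cauchy product. *)
Lemma odot_vec_cons F G x r :
  odot_vec F G (x :: r) =
  \sum_(e < (minn 1 x).+1) \sum_(a < (x - e).+1)
    (-1) ^+ e * odot_vec (fun r => F (nat_of_ord a :: r)) (fun r => G ((x - e - a)%N :: r)) r.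
Proof.
rewrite /odot_vec map_cons big_boxes_cons; apply: eq_bigr => e _.
under eq_bigr do rewrite vsub_cons big_boxes_cons.
rewrite exchange_big; apply: eq_bigr => a _; rewrite mulr_sumr.
apply: eq_bigr => s _; rewrite mulr_sumr; apply: eq_bigr => b _.
by rewrite /= vsub_cons exprD !mulrA.
Qed.

Lemma eqXMl N r p q : eqX N p q -> eqX N (r * p) (r * q).
Proof. by apply: eqXM; exact: eqX_refl. Qed.

Lemma eqXMr N r p q : eqX N p q -> eqX N (p * r) (q * r).
Proof. by move=> h; apply: eqXM => //; exact: eqX_refl. Qed.

Lemma eqX_mulXn N k (p : {poly rat}) : (N < k)%N -> eqX N ('X^k * p) 0.
Proof. by move=> h; rewrite /eqX subr0 dvdp_mulr // dvdp_exp2l. Qed.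

Lemma boxgfZ i B c F : boxgf i B (fun r => c * F r) = c *: boxgf i B F.
Proof. by rewrite /boxgf scaler_sumr; apply: eq_bigr => r _; rewrite scalerA. Qed.

Lemma boxgf_sum i B (I : Type) (s : seq I) (P : pred I) F :
  boxgf i B (fun r => \sum_(j <- s | P j) F j r) = \sum_(j <- s | P j) boxgf i B (F j).
Proof. by rewrite /boxgf exchange_big; apply: eq_bigr => r _; rewrite scaler_suml. Qed.

Lemma eqX_horner N m (W : {poly {poly rat}}) : (0 < m)%N ->
  eqX N W.['X^m] (\sum_(x < N.+1) 'X^(m * x) * W`_x).
Proof.
move=> m0; rewrite (horner_coef_wide _ (leq_maxl (size W) N.+1)).
rewrite -(big_mkord xpredT (fun x => W`_x * 'X^m ^+ x)).
rewrite -(big_mkord xpredT (fun x => 'X^(m * x) * W`_x)).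
rewrite (big_cat_nat (n := N.+1)) ?leq_maxr //= -[X in eqX _ _ X]addr0.
apply: eqXD.
  by apply: eqX_sum => x _; rewrite mulrC -exprM; exact: eqX_refl.
rewrite big_nat; elim/big_rec: _ => [|x p /andP[hx _] hp]; first exact: eqX_refl.
rewrite -[0]addr0; apply: eqXD hp; rewrite mulrC -exprM; apply: eqX_mulXn.
by rewrite (leq_trans hx) // leq_pmull.
Qed.

(** Cauchy product in the variable X^m: both factors are values at X^m of polynomials with
    polynomial coefficients, and the terms of their product with index beyond N drop out. *)
Lemma eqX_conv N m (U V : nat -> {poly rat}) : (0 < m)%N ->
  eqX N ((\sum_(x < N.+1) 'X^(m * x) * U x) * (\sum_(y < N.+1) 'X^(m * y) * V y))
        (\sum_(x < N.+1) 'X^(m * x) * \sum_(a < x.+1) U a * V (x - a)%N).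
Proof.
move=> m0.
pose p := \poly_(x < N.+1) U x; pose q := \poly_(x < N.+1) V x.
have e (W : nat -> {poly rat}) :
    \sum_(x < N.+1) 'X^(m * x) * W x = (\poly_(x < N.+1) W x).['X^m].
  by rewrite horner_poly; apply: eq_bigr => x _; rewrite mulrC exprM.
rewrite !e -hornerM; apply: (eqX_trans (eqX_horner _ _ m0)).
apply: eqX_sum => x _; rewrite coefM (_ : \sum_(j < _) _ = \sum_(a < x.+1) U a * V (x - a)%N).
  exact: eqX_refl.
apply: eq_bigr => a _; have := ltn_ord x; have := ltn_ord a => ha hx.
by rewrite !coef_poly; do 2 (case: ltnP => ?; last lia).
Qed.

(** Induction on the number of part sizes. In the first coordinate the sum is the Cauchy product [C]
    multiplied by 1 - u, that is, its difference sequence [dC]; the geometric series in the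
    partition function sums the differences back to [C]. *)
Lemma boxgf_odot N L i F G (one := fun _ : seq nat => 1 : rat) :
  eqX N (boxgf i (nseq L N) (odot_vec F G) * boxgf i (nseq L N) one)
        (boxgf i (nseq L N) F * boxgf i (nseq L N) G).
Proof.
elim: L i F G => [|L IH] i F G /=.
  by rewrite !boxgf_nil odot_vec_nil /one mulr1 polyCM; exact: eqX_refl.
rewrite !boxgf_cons -/one.
set Z := boxgf i.+1 (nseq L N) one.
pose U a := boxgf i.+1 (nseq L N) (fun r => F (a :: r)).
pose V a := boxgf i.+1 (nseq L N) (fun r => G (a :: r)).
pose C x : {poly rat} := \sum_(a < x.+1) U a * V (x - a)%N.
pose dC x := if x is x'.+1 then C x - C x' else C x.
have hZ : \sum_(y < N.+1) 'X^(i.+1 * y) * Z = (\sum_(y < N.+1) 'X^(i.+1 * y) * 1) * Z.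
  by rewrite mulr_suml; apply: eq_bigr => y _; rewrite mulr1.
rewrite hZ mulrCA mulrC mulr_suml.
have hdC (x : 'I_N.+1) : eqX N
  ('X^(i.+1 * x) * boxgf i.+1 (nseq L N) (fun r => odot_vec F G (nat_of_ord x :: r)) * Z)
  ('X^(i.+1 * x) * dC x).
  rewrite -mulrA; apply: eqXMl.
  rewrite (eq_boxgf _ _ (odot_vec_cons F G x)) boxgf_sum mulr_suml.
  have -> : dC x = \sum_(e < (minn 1 x).+1) (-1) ^+ e * C (x - e)%N.
    case: (nat_of_ord x) => [|x'] /=; first by rewrite big_ord1 expr0 mul1r.
    by rewrite minnSS min0n !big_ord_recl big_ord0 addr0 /= subn0 subSS subn0 mul1r mulN1r.
  apply: eqX_sum => e _; rewrite boxgf_sum mulr_suml mulr_sumr.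
  apply: eqX_sum => a _; rewrite boxgfZ -scalerAl -mul_polyC.
  have -> : ((-1) ^+ e)%:P = (-1) ^+ e :> {poly rat} by rewrite rmorphXn rmorphN1.
  by apply: eqXMl; exact: IH.
apply: (eqX_trans (eqXMr _ (eqX_sum _ (fun x _ => hdC x)))).
apply: (eqX_trans (eqX_conv N dC (fun=> 1) (ltn0Sn i))).
apply: eqX_sym; apply: (eqX_trans (eqX_conv N U V (ltn0Sn i))).
apply: eqX_sum => x _; apply: eqXMl; rewrite -/(C x).
have -> : \sum_(a < x.+1) dC a * 1 = C x.
  elim: (nat_of_ord x) => [|y IHy]; first by rewrite big_ord1 mulr1.
  by rewrite big_ord_recr /= IHy mulr1 addrC subrK.
exact: eqX_refl.
Qed.

(** * The q-brackets of the generators *)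

(** The denominator is multiplied out, so that no inverse series occurs before [has_bracketP]. *)
Definition has_bracket (f : intpart -> rat) (s : series) :=
  forall N, eqX N (trunc N (qnum f)) (trunc N s * trunc N (qnum one_fn)).

Definition one_series : series := fun n => (n == 0%N)%:R.

Lemma trunc_one N : trunc N one_series = 1.
Proof.
apply/polyP => i; rewrite coef_poly coef1 /one_series; case: ltnP => // iN.
by case: eqP iN => // ->.
Qed.

Lemma qnum1_0 : qnum one_fn 0 = 1.
Proof. by rewrite /qnum /= big_cons big_nil /wt big_ord0 eqxx addr0. Qed.

Lemma eq_trunc N s t : s =1 t -> trunc N s = trunc N t.
Proof. by move=> e; apply: eq_poly => i _; rewrite e. Qed.

Lemma has_bracketP f s : has_bracket f s -> qbracket f =1 s.
Proof.
move=> h n; set z := qnum one_fn.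
have zs : eqX n (trunc n z * trunc n (sinv z)) 1.
  rewrite -(trunc_one n); apply: eqX_trans (eqX_sym (trunc_smul _ _ _)) _.
  rewrite (eq_trunc _ (t := one_series)); first exact: eqX_refl.
  by move=> m; rewrite smul_sinv // /z qnum1_0 oner_neq0.
have := eqX_trans (trunc_smul n _ _) (eqXMr (trunc n (sinv z)) (h n)).
rewrite -mulrA => /eqX_trans/(_ (eqXMl _ zs)); rewrite mulr1.
by move/eqX_coefP/(_ n (leqnn n)); rewrite !coef_trunc.
Qed.

Lemma has_bracket_one : has_bracket one_fn one_series.
Proof. by move=> N; rewrite trunc_one mul1r; exact: eqX_refl. Qed.

Lemma has_bracket_odot f g s t :
  has_bracket f s -> has_bracket g t -> has_bracket (odot f g) (smul s t).
Proof.
move=> hf hg N; set z := trunc N (qnum one_fn).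
(* The product of the two brackets carries the partition function squared; one copy is cancelled,
   its constant term being 1. *)
apply: (@eqX_cancel N z); first by rewrite coef_trunc // /z qnum1_0 oner_neq0.
have ez : eqX N z (boxgf 0 (nseq N N) (fun=> 1)) by exact: trunc_qnum.
apply: eqX_trans (eqXM (trunc_qnum _ _) ez) _.
rewrite (eq_boxgf _ _ (odot_mkpart f g)).
apply: eqX_trans (boxgf_odot _ _ _ _ _) _.
apply: eqX_trans (eqXM (eqX_sym (trunc_qnum _ _)) (eqX_sym (trunc_qnum _ _))) _.
apply: eqX_trans (eqXM (hf N) (hg N)) _; rewrite -/z.
rewrite mulrACA mulrA; apply: eqXMr; apply: eqXMr.
exact: eqX_sym (trunc_smul _ _ _).
Qed.

Lemma trunc_sum N (I : Type) (r : seq I) (c : I -> rat) (s : I -> series) :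
  trunc N (fun n => \sum_(i <- r) c i * s i n) = \sum_(i <- r) (c i)%:P * trunc N (s i).
Proof.
apply/polyP => n; rewrite coef_sum coef_poly; case: ltnP => nN.
  by apply: eq_bigr => i _; rewrite coefCM coef_trunc.
by rewrite big1 // => i _; rewrite coefCM coef_poly ltnNge nN mulr0.
Qed.

Lemma has_bracket_sum (I : eqType) (r : seq I) (c : I -> rat) f s :
  (forall i, i \in r -> has_bracket (f i) (s i)) ->
  has_bracket (fun la => \sum_(i <- r) c i * f i la)
              (fun n => \sum_(i <- r) c i * s i n).
Proof.
move=> h N; rewrite (eq_trunc _ (t := fun n => \sum_(i <- r) c i * qnum (f i) n)).
  rewrite !trunc_sum mulr_suml big_seq [X in eqX _ _ X]big_seq; apply: eqX_sum => i ir.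
  by rewrite -mulrA; apply: eqXMl; exact: h.
move=> n; rewrite /qnum exchange_big; apply: eq_bigr => i _.
by rewrite mulr_sumr.
Qed.

Lemma big_divisors (V : nmodType) N n (F : nat -> V) : (0 < n <= N)%N ->
  \sum_(d <- divisors n) F d = \sum_(1 <= d < N.+1 | (d %| n)%N) F d.
Proof.
case/andP=> n0 nN; rewrite -[RHS]big_filter; apply: perm_big; apply: uniq_perm.
- exact: divisors_uniq.
- by rewrite filter_uniq // iota_uniq.
move=> d; rewrite -dvdn_divisors // mem_filter mem_index_iota.
case dn : (d %| n)%N => //=; rewrite ltnS.
by rewrite (dvdn_gt0 n0 dn) (leq_trans (dvdn_leq n0 dn) nN).
Qed.

Lemma big_divisor_pairs (V : nmodType) N n (G : nat -> nat -> V) : (0 < n <= N)%N ->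
  \sum_(d <- divisors n) G d (n %/ d)%N =
  \sum_(1 <= d < N.+1) \sum_(0 <= y < N.+1 | (d * y == n)%N) G d y.
Proof.
move=> nN; have /andP[n0 leN] := nN.
rewrite (big_divisors _ nN) big_mkcond big_nat [RHS]big_nat.
apply: eq_bigr => d /andP[d0 _]; case: ifP => dn.
  rewrite [RHS]big_mkcond (bigD1_seq (n %/ d)%N) ?iota_uniq //=; last first.
    by rewrite mem_index_iota ltnS (leq_trans (leq_div _ _)).
  rewrite mulnC divnK // eqxx big1 ?addr0 // => y yd.
  by case: eqP => // e; case/eqP: yd; rewrite -e mulKn.
rewrite big1 // => y /eqP e; move: dn; rewrite -e dvdn_mulr //.
Qed.

(** The value at 0 is set to 0 because [0 ^+ 0] would be 1 for [l = 1]. *)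
Definition pos_pow (l y : nat) : rat := if y == 0%N then 0 else y%:R ^+ l.-1.

Lemma faulhaberE l n : faulhaber l n = \sum_(y < n.+1) pos_pow l y.
Proof.
rewrite /faulhaber big_ord_recl add0r big_add1 /= big_mkord.
by apply: eq_bigr => i _.
Qed.

Definition faulhaber_sum k l (i : nat) (r : seq nat) : rat :=
  \sum_(j < size r) (i + j).+1%:R ^+ k * faulhaber l (nth 0%N r j).

Lemma faulhaber_sum_cons k l i x r :
  faulhaber_sum k l i (x :: r) = i.+1%:R ^+ k * faulhaber l x + faulhaber_sum k l i.+1 r.
Proof.
rewrite /faulhaber_sum big_ord_recl /= addn0; congr (_ + _).
by apply: eq_bigr => j _; rewrite addnS.
Qed.

Lemma boxgfD i B F G : boxgf i B (fun r => F r + G r) = boxgf i B F + boxgf i B G.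
Proof. by rewrite /boxgf -big_split; apply: eq_bigr => r _; rewrite scalerDl. Qed.

(** F_l(x) is a partial sum of y^(l-1), so its generating series is that of y^(l-1) times a
    geometric series, which is exactly the factor of the part size i+1 in the partition function. *)
Lemma boxgf_faulhaber N L i k l (one := fun _ : seq nat => 1 : rat) :
  eqX N (boxgf i (nseq L N) (faulhaber_sum k l i))
        ((\sum_(j < L) \sum_(y < N.+1)
            ((i + j).+1%:R ^+ k * pos_pow l y) *: 'X^((i + j).+1 * y))
         * boxgf i (nseq L N) one).
Proof.
elim: L i => [|L IH] i.
  by rewrite !boxgf_nil big_ord0 mul0r /faulhaber_sum big_ord0; exact: eqX_refl.
rewrite /= !boxgf_cons -/one; set Z := boxgf i.+1 (nseq L N) one.
rewrite [\sum_(j < L.+1) _]big_ord_recl mulrDl addn0.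
have -> : \sum_(x < N.+1) 'X^(i.+1 * x) * boxgf i.+1 (nseq L N) (fun r => faulhaber_sum k l i (nat_of_ord x :: r))
  = i.+1%:R ^+ k *: ((\sum_(x < N.+1) 'X^(i.+1 * x) * (faulhaber l x)%:P) * Z)
    + (\sum_(x < N.+1) 'X^(i.+1 * x)) * boxgf i.+1 (nseq L N) (faulhaber_sum k l i.+1).
  rewrite !mulr_suml scaler_sumr -big_split; apply: eq_bigr => x _.
  rewrite (eq_boxgf _ _ (faulhaber_sum_cons k l i x)) boxgfD mulrDr; congr (_ + _).
  rewrite (@eq_boxgf _ _ _ (fun r => i.+1%:R ^+ k * faulhaber l x * one r)).
    by rewrite boxgfZ -scalerA -mulrA mul_polyC scalerAr.
  by move=> r; rewrite mulr1.
apply: eqXD.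
  have := eqX_conv N (fun y => (pos_pow l y)%:P) (fun=> 1) (ltn0Sn i).
  under [X in eqX _ _ X -> _]eq_bigr => x _.
    under eq_bigr do rewrite mulr1.
    rewrite -rmorph_sum -faulhaberE; over.
  move/eqX_sym => /(eqXMr Z) /(eqXMl (i.+1%:R ^+ k)%:P).
  rewrite !mul_polyC => h; apply: eqX_trans h _.
  rewrite -mulrA scalerAl; apply: eqXM.
    rewrite scaler_sumr; apply: eqX_sum => y _.
    by rewrite mulrC mul_polyC scalerA; exact: eqX_refl.
  rewrite mulr_suml; apply: eqX_sum => y _.
  by rewrite mulr1; exact: eqX_refl.
apply: eqX_trans (eqXMl _ (IH i.+1)) _; rewrite mulrCA; apply: eqXM.
  by apply: eqX_sum => j _; rewrite /= addnS; exact: eqX_refl.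
by rewrite mulr_suml; exact: eqX_refl.
Qed.

Definition Tconst k l : rat := - bern (k + l) / (2 * (k + l))%:R * ((l == 1%N) + (k == 0%N))%:R.

Definition Tser k l : series := fun n =>
  if n == 0%N then Tconst k l
  else \sum_(d <- divisors n) d%:R ^+ k * (n %/ d)%N%:R ^+ l.-1.

Lemma Tkl_mkpart k l r : (0 < l)%N -> ~~ odd (k + l) ->
  Tkl k l (mkpart r) = Tconst k l + faulhaber_sum k l 0 r.
Proof.
move=> l0 okl; rewrite /Tkl l0 okl /=; congr (_ + _).
(* The zeros removed by [strip0] contribute F_l(0) = 0. *)
have [c e] := strip0K r; rewrite [in RHS]e /faulhaber_sum size_cat big_split_ord /=.
rewrite [X in _ = _ + X]big1 ?addr0 => [|j _].
  by apply: eq_bigr => j _; rewrite nth_cat ltn_ord.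
rewrite nth_cat ltnNge leq_addr /= addKn nth_nseq if_same.
by rewrite /faulhaber big_geq // mulr0.
Qed.

Lemma has_bracket_Tkl k l : (0 < l)%N -> ~~ odd (k + l) ->
  has_bracket (Tkl k l) (Tser k l).
Proof.
move=> l0 okl N; pose one := fun _ : seq nat => 1 : rat.
have ez : eqX N (trunc N (qnum one_fn)) (boxgf 0 (nseq N N) one) by exact: trunc_qnum.
apply: eqX_trans (trunc_qnum _ _) _.
rewrite (@eq_boxgf _ _ _ (fun r => Tconst k l * one r + faulhaber_sum k l 0 r)); last first.
  by move=> r /=; rewrite Tkl_mkpart // mulr1.
rewrite boxgfD boxgfZ; apply: eqX_sym; apply: eqX_trans (eqXMl _ ez) _.
apply: eqX_sym; apply: eqX_trans (eqXD (eqX_refl _ _) (boxgf_faulhaber _ _ _ _ _)) _.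
rewrite -/one -mul_polyC -mulrDl; apply: eqXMr.
apply/eqX_coefP => n nN; rewrite coef_trunc // coefD coefC coef_sum /Tser.
under eq_bigr => j _ do rewrite coef_sum.
under eq_bigr => j _ do under eq_bigr => y _ do rewrite coefZ coefXn add0n.
rewrite -(big_mkord xpredT (fun j => \sum_(y < N.+1) (j.+1%:R ^+ k * pos_pow l y) * (n == (j.+1 * y)%N)%:R)).
case: eqP => [->|/eqP n0].
  rewrite big1_seq ?addr0 // => j _; rewrite big1 // => y _.
  by rewrite eq_sym muln_eq0 /= /pos_pow; case: eqP; rewrite ?mulr0 ?mul0r.
rewrite add0r (big_divisor_pairs (N := N) (fun d y => d%:R ^+ k * y%:R ^+ l.-1)) ?lt0n ?n0 //.
rewrite big_add1 /=; apply: eq_bigr => j _; rewrite [RHS]big_mkcond big_mkord.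
apply: eq_bigr => y _; rewrite eq_sym; case: eqP => [e|_]; last by rewrite mulr0.
rewrite mulr1 /pos_pow; case: eqP => // y0.
by move: n0; rewrite -e y0 muln0.
Qed.

(** * Bernoulli numbers *)

Lemma size_bernl n : size (bernl n) = n.+1.
Proof. by elim: n => //= n IH; rewrite size_rcons IH. Qed.

Lemma nth_bernl n i : (i <= n)%N -> (bernl n)`_i = bern i.
Proof.
elim: n => [|n IH]; first by rewrite leqn0 => /eqP->.
rewrite leq_eqVlt => /orP[/eqP-> //|iN].
by rewrite /= nth_rcons size_bernl iN IH.
Qed.

Lemma bern0 : bern 0 = 1. Proof. by []. Qed.

Lemma bern_rec n : \sum_(j < n) 'C(n, j)%:R * bern j = (n == 1%N)%:R.
Proof.
case: n => [|[|n]]; first by rewrite big_ord0.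
  by rewrite big_ord1 bern0 mulr1.
rewrite big_ord_recr /= {2}/bern /= nth_rcons size_bernl ltnn eqxx.
rewrite -[n.+2]/(n.+1.+1) binSn mulrC divfK ?pnatr_eq0 //.
rewrite addrC; apply/eqP; rewrite addrC subr_eq0; apply/eqP.
by apply: eq_bigr => j _; rewrite nth_bernl // -ltnS.
Qed.

(** On exponential generating functions the transform is multiplication by e^t - 1; its coefficient
    of index n+1 determines the term of index n, whose factor is n+1. *)
Lemma bin_rec_inj (u v : nat -> rat) :
  (forall n, \sum_(j < n) 'C(n, j)%:R * u j = \sum_(j < n) 'C(n, j)%:R * v j) ->
  u =1 v.
Proof.
move=> h n; elim/ltn_ind: n => n IH; have := h n.+1; rewrite !big_ord_recr /= binSn.
under eq_bigr do rewrite IH //.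
by move/addrI/mulfI; apply; rewrite pnatr_eq0.
Qed.

Lemma mul_bin_swap n j i : (i <= j <= n)%N ->
  ('C(n, j) * 'C(j, i) = 'C(n, i) * 'C(n - i, j - i))%N.
Proof.
case/andP=> ij jn.
have f0 : (0 < i`! * (j - i)`! * (n - j)`!)%N by rewrite !muln_gt0 !fact_gt0.
apply/eqP; rewrite -(eqn_pmul2r f0); apply/eqP.
have h1 := bin_fact jn; have h2 := bin_fact ij.
have h3 := bin_fact (leq_trans ij jn).
have h4 : (j - i <= n - i)%N by rewrite leq_sub2r.
have := bin_fact h4; rewrite (_ : n - i - (j - i) = n - j)%N; last by lia.
move=> h5.
transitivity ('C(n, j) * ('C(j, i) * (i`! * (j - i)`!) * (n - j)`!))%N; first by ring.
rewrite h2 h1 -h3 -h5; ring.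
Qed.

Lemma big_triangle (V : nmodType) n (F : nat -> nat -> V) :
  \sum_(j < n) \sum_(i < j.+1) F i j = \sum_(i < n) \sum_(k < n - i) F i (i + k)%N.
Proof.
elim: n => [|n IH]; first by rewrite !big_ord0.
rewrite big_ord_recr IH [RHS]big_ord_recr /= subSnn big_ord1 addn0 big_ord_recr /=.
rewrite addrA -big_split; congr (_ + _); apply: eq_bigr => i _ /=.
by rewrite subSn ?(ltnW (ltn_ord i)) // big_ord_recr /= subnKC // ltnW.
Qed.

(** For exponential generating functions: (e^t - 1)(ab) = a((e^t - 1)b). *)
Lemma bin_conv_swap (a b : nat -> rat) n :
  \sum_(j < n) 'C(n, j)%:R * (\sum_(i < j.+1) 'C(j, i)%:R * a i * b (j - i)%N) =
  \sum_(i < n) 'C(n, i)%:R * a i * (\sum_(j < n - i) 'C(n - i, j)%:R * b j).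
Proof.
under eq_bigr do rewrite mulr_sumr.
rewrite (big_triangle n (fun i j => 'C(n, j)%:R * ('C(j, i)%:R * a i * b (j - i)%N))).
apply: eq_bigr => i _; rewrite mulr_sumr; apply: eq_bigr => k _.
have ik : (i <= i + k <= n)%N by have := ltn_ord k; lia.
rewrite !mulrA -natrM (mul_bin_swap ik) addKn natrM; ring.
Qed.

(* Binomial recurrence of both sides, using [bin_rec_inj]; equivalently, the
   generating function b of B_n/n! satisfies b^2 = b - t b' - t b. *)
Lemma bern_conv n :
  \sum_(r < n.+1) 'C(n, r)%:R * bern r * bern (n - r) =
  bern n - n%:R * bern n - n%:R * bern n.-1.
Proof.
move: n; apply: bin_rec_inj => n; rewrite bin_conv_swap.
under eq_bigr do rewrite bern_rec.
case: n => [|n]; first by rewrite !big_ord0.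
(* The transform of the Bernoulli numbers is t, so only the index [i = n] survives. *)
transitivity (n.+1%:R * bern n).
  rewrite big_ord_recr /= subSnn eqxx mulr1 binSn big1 ?add0r // => i _.
  by case: eqP => [|_]; [have := ltn_ord i; lia | rewrite mulr0].
have h1 : \sum_(j < n.+1) 'C(n.+1, j)%:R * (j%:R * bern j) =
   n.+1%:R * ((n.+1 == 1%N)%:R - (n == 1%N)%:R - bern n).
  rewrite big_ord_recl mul0r mulr0 add0r.
  have := bern_rec n.+1; rewrite big_ord_recl bin0 bern0 mulr1 => h1.
  have := bern_rec n; rewrite -[LHS](addrK (bern n)).
  have -> : \sum_(j < n) 'C(n, j)%:R * bern j + bern n = \sum_(j < n.+1) 'C(n, j)%:R * bern j.
    by rewrite big_ord_recr /= binn mul1r.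
  rewrite big_ord_recl bin0 bern0 mulr1 => h2.
  rewrite -h1 -h2.
  transitivity (n.+1%:R * (\sum_(i < n) 'C(n.+1, bump 0 i)%:R * bern (bump 0 i) - \sum_(i < n) 'C(n, bump 0 i)%:R * bern (bump 0 i))); last by ring.
  rewrite -sumrB mulr_sumr; apply: eq_bigr => i _; rewrite /bump /= add1n.
  rewrite mulrA [_ * _.+1%:R]mulrC -natrM -mul_bin_diag /= binS !natrM natrD; ring.
have h2 : \sum_(j < n.+1) 'C(n.+1, j)%:R * (j%:R * bern j.-1) =
   n.+1%:R * (n == 1%N)%:R.
  rewrite big_ord_recl mul0r mulr0 add0r -bern_rec mulr_sumr.
  apply: eq_bigr => i _; rewrite lift0 mulrA [_ * _.+1%:R]mulrC -natrM.
  by rewrite -mul_bin_diag natrM mulrA.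
have -> : \sum_(j < n.+1) 'C(n.+1, j)%:R * (bern j - j%:R * bern j - j%:R * bern j.-1)
  = \sum_(j < n.+1) 'C(n.+1, j)%:R * bern j
    - \sum_(j < n.+1) 'C(n.+1, j)%:R * (j%:R * bern j)
    - \sum_(j < n.+1) 'C(n.+1, j)%:R * (j%:R * bern j.-1).
  by rewrite -!sumrB; apply: eq_bigr => j _; ring.
rewrite h1 h2 bern_rec.
case: n {h1 h2} => [|n] /=; rewrite ?mulr0 ?mulr1; ring.
Qed.

Lemma sum_bin_sign n : (0 < n)%N -> \sum_(k < n) 'C(n, k)%:R * (-1) ^+ k = - (-1) ^+ n :> rat.
Proof.
move=> n0; apply/eqP; rewrite -addr_eq0; apply/eqP.
have := exprDn (1 : rat) (-1) n; rewrite subrr expr0n eqn0Ngt n0 big_ord_recr /= binn => e.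
rewrite [RHS]e subnn expr0 mul1r; congr (_ + _); apply: eq_bigr => i _.
by rewrite expr1n mul1r mulr_natl.
Qed.

(** For b(t) = t/(e^t - 1) this is b(-t) = b(t) + t. It is checked after multiplication by e^t - 1,
    from two evaluations of (e^t - 1) e^(-t) b(-t). *)
Lemma bern_sign n : (-1) ^+ n * bern n = bern n + (n == 1%N)%:R.
Proof.
move: n; apply: bin_rec_inj => n.
(* The index j = 1 lies below n only for n at least 2; the subtraction corrects the case n = 1. *)
have pick (c : nat -> rat) : \sum_(j < n) 'C(n, j)%:R * (c j * (j == 1%N :> nat)%:R) = c 1%N * (n - (n == 1))%:R.
  case: n => [|[|n]]; rewrite ?big_ord0 ?big_ord1 /= ?mulr0 //.
  rewrite big_ord_recl mulr0 mulr0 add0r big_ord_recl big1 => [|i _]; last by rewrite !mulr0.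
  by rewrite lift0 /= bin1 subn0 addr0 mulr1 mulrC.
have := bin_conv_swap (fun i => (-1) ^+ i * bern i) (fun k => (-1) ^+ k) n.
have -> : \sum_(j < n) 'C(n, j)%:R * (\sum_(i < j.+1) 'C(j, i)%:R * ((-1) ^+ i * bern i) * (-1) ^+ (j - i))
  = \sum_(j < n) 'C(n, j)%:R * ((-1) ^+ j * bern j)
    + \sum_(j < n) 'C(n, j)%:R * ((-1) ^+ j * (j == 1%N :> nat)%:R).
  rewrite -big_split; apply: eq_bigr => j _; rewrite /= -mulrDr -mulrDr; congr (_ * _).
  rewrite -bern_rec addrC.
  have -> : \sum_(i < j) 'C(j, i)%:R * bern i + bern j = \sum_(i < j.+1) 'C(j, i)%:R * bern i.
    by rewrite big_ord_recr /= binn mul1r.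
  rewrite mulr_sumr; apply: eq_bigr => i _.
  have -> : (-1) ^+ j = (-1) ^+ i * (-1) ^+ (j - i) :> rat.
    by rewrite -exprD subnKC // -ltnS.
  by ring.
have -> : \sum_(i < n) 'C(n, i)%:R * ((-1) ^+ i * bern i) * (\sum_(j < n - i) 'C(n - i, j)%:R * (-1) ^+ j)
  = - (-1) ^+ n * (n == 1%N)%:R.
  rewrite -bern_rec mulr_sumr; apply: eq_bigr => i _.
  rewrite sum_bin_sign ?subn_gt0 //.
  have -> : (-1) ^+ n = (-1) ^+ i * (-1) ^+ (n - i) :> rat.
    by rewrite -exprD subnKC // ltnW.
  by ring.
rewrite (pick (fun j => (-1) ^+ j)).
under [X in _ -> _ = X]eq_bigr => j _.
  rewrite mulrDr -[(nat_of_ord j == 1%N)%:R]mul1r; over.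
rewrite big_split /= bern_rec (pick (fun=> 1)) expr1.
move=> /eqP; rewrite -subr_eq0 => /eqP h; apply/eqP; rewrite -subr_eq0 -[X in _ == X]h.
by case: n {pick h} => [|[|n]] /=; apply/eqP; rewrite ?expr1; ring.
Qed.

Lemma bern_odd n : odd n -> (1 < n)%N -> bern n = 0.
Proof.
move=> on n1; have := bern_sign n; rewrite -signr_odd on (gtn_eqF n1) addr0 mulN1r.
by move=> e; lra.
Qed.

(** Induction on d: the difference of the right side between d and d+1 is a coefficient of e^(dt)
    b(t) (e^t - 1) = t e^(dt), where b is the generating function of B_n/n!. *)
Lemma sum_pow M d : \sum_(a < d) a%:R ^+ M * M.+1%:R =
  \sum_(j < M.+1) 'C(M.+1, j)%:R * bern j * d%:R ^+ (M.+1 - j) :> rat.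
Proof.
elim: d => [|d IH].
  rewrite big_ord0 big1 // => j _; rewrite expr0n subn_eq0 leqNgt ltn_ord mulr0 //.
rewrite big_ord_recr IH /=; apply/eqP; rewrite eq_sym addrC -subr_eq -sumrB; apply/eqP.
have -> : \sum_(j < M.+1) ('C(M.+1, j)%:R * bern j * d.+1%:R ^+ (M.+1 - j) - 'C(M.+1, j)%:R * bern j * d%:R ^+ (M.+1 - j))
 = \sum_(j < M.+1) 'C(M.+1, j)%:R * bern j * (\sum_(i < M.+1 - j) 'C(M.+1 - j, i)%:R * d%:R ^+ i).
  apply: eq_bigr => j _; rewrite -mulrBr; congr (_ * _).
  rewrite -nat1r exprDn big_ord_recr /= subnn expr0 mul1r binn addrK.
  by apply: eq_bigr => i _; rewrite expr1n mul1r mulr_natl.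
rewrite -(bin_conv_swap bern (fun i => d%:R ^+ i)).
transitivity (\sum_(j < M.+1) 'C(M.+1, j)%:R * (\sum_(i < j.+1) 'C(j, i)%:R * (d%:R ^+ i) * bern (j - i)) : rat).
  apply: eq_bigr => j _; congr (_ * _); rewrite (reindex_inj rev_ord_inj) /=.
  apply: eq_bigr => i _; have ij : (i <= j)%N by rewrite -ltnS.
  by rewrite subSS bin_sub // subKn // mulrAC.
rewrite (bin_conv_swap (fun i => d%:R ^+ i) bern).
under eq_bigr do rewrite bern_rec.
rewrite big_ord_recr /= subSnn eqxx mulr1 binSn big1 ?add0r => [|i _]; first by rewrite mulrC.
by case: eqP => [|_]; [have := ltn_ord i; lia | rewrite mulr0].
Qed.

Lemma big_even_odd (V : nmodType) n (F : nat -> V) :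
  \sum_(r < 2 * n) F r = \sum_(j < n) F (2 * j)%N + \sum_(j < n) F (2 * j).+1.
Proof.
elim: n => [|n IH]; first by rewrite !big_ord0 addr0.
by rewrite mulnS !big_ord_recr /= IH -addrA addrACA.
Qed.

(** The even-index part of [bern_conv], with the end terms r = 0 and r = 2m+2 moved to the right. *)
Lemma bern_euler m : (0 < m)%N ->
  \sum_(j < m) 'C(2 * m.+1, 2 * j.+1)%:R * bern (2 * j.+1) * bern (2 * (m - j)) =
  - (2 * m + 3)%:R * bern (2 * m.+1).
Proof.
move=> m0; have := bern_conv (2 * m.+1).
rewrite big_ord_recr (big_even_odd _ (fun r => 'C(_, r)%:R * bern r * bern (_ - r))).
(* Both indices are odd and add up to 2m+2, which is at least 4, so one of them exceeds 1. *)
rewrite [\sum_(j < m.+1) ('C(_, (2 * j).+1)%:R * _ * _)]big1 => [|j _]; last first.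
  have hj := ltn_ord j.
  case: (ltnP 0 j) => j0; first by rewrite (bern_odd (n := (2 * j).+1)) ?mulr0 ?mul0r //; lia.
  by rewrite (bern_odd (n := (2 * m.+1 - (2 * j).+1)%N)) ?mulr0 //; lia.
rewrite big_ord_recl /= subn0 bin0 bern0 subnn bern0 binn addr0.
rewrite (bern_odd (n := (2 * m.+1).-1)); [|lia|lia].
have -> : \sum_(i < m) 'C(2 * m.+1, 2 * bump 0 i)%:R * bern (2 * bump 0 i) * bern (2 * m.+1 - 2 * bump 0 i)
  = \sum_(j < m) 'C(2 * m.+1, 2 * j.+1)%:R * bern (2 * j.+1) * bern (2 * (m - j)).
  by apply: eq_bigr => j _; rewrite /bump add1n -mulnBr subSS.
move=> h; rewrite !natrD !natrM in h *; lra.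
Qed.

(** * Sums over the solutions of ax + by = n *)

Definition pairs (n : nat) : seq (nat * nat) :=
  [seq (a, x) | a <- index_iota 1 n.+1, x <- index_iota 1 n.+1].

(* The solutions ((a, x), (b, y)) of [a x + b y = n] in positive integers. *)
Definition quads (n : nat) : seq ((nat * nat) * (nat * nat)) :=
  [seq q <- [seq (u, v) | u <- pairs n, v <- pairs n]
     | (q.1.1 * q.1.2 + q.2.1 * q.2.2 == n)%N].

Lemma quads_uniq n : uniq (quads n).
Proof.
have up : uniq (pairs n).
  by apply: allpairs_uniq; rewrite ?iota_uniq // => -[? ?] [? ?].
by apply/filter_uniq/allpairs_uniq => // -[? ?] [? ?].
Qed.

Lemma mem_quads n a x b y : (((a, x), (b, y)) \in quads n) =
  [&& 0 < a, 0 < x, 0 < b, 0 < y & a * x + b * y == n]%N.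
Proof.
have mp c z : ((c, z) \in pairs n) = [&& 0 < c <= n & 0 < z <= n]%N.
  apply/allpairsP/idP => [[[c' z'] [/= + + [-> ->]]]|/andP[hc hz]].
    by rewrite !mem_index_iota !ltnS => -> ->.
  by exists (c, z); split; rewrite // mem_index_iota ltnS.
rewrite mem_filter /= andbC.
have -> : (((a, x), (b, y)) \in [seq (u, v) | u <- pairs n, v <- pairs n])
    = ((a, x) \in pairs n) && ((b, y) \in pairs n).
  apply/allpairsP/andP => [[[u v] [/= hu hv e]]|[hu hv]].
    by case: e hu hv => <- <-.
  by exists ((a, x), (b, y)).
rewrite !mp; apply/idP/idP; last first.
  case/and5P=> a0 x0 b0 y0 /eqP e; rewrite e eqxx a0 x0 b0 y0 /= andbT.
  by apply/andP; split; apply/andP; split; nia.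
by case/andP=> /andP[/andP[/andP[-> _] /andP[-> _]] /andP[/andP[-> _] /andP[-> _]]].
Qed.

Lemma big_reindex_uniq (T : eqType) (V : nmodType) (s : seq T) (P P' : pred T)
    (phi psi : T -> T) (F : T -> V) : uniq s ->
  (forall q, q \in s -> P q -> [/\ phi q \in s, P' (phi q) & psi (phi q) = q]) ->
  (forall q, q \in s -> P' q -> [/\ psi q \in s, P (psi q) & phi (psi q) = q]) ->
  \sum_(q <- s | P' q) F q = \sum_(q <- s | P q) F (phi q).
Proof.
move=> us h h'; rewrite -big_filter -[RHS]big_filter -(big_map phi xpredT).
apply: perm_big; apply: uniq_perm; first exact: filter_uniq.
- rewrite map_inj_in_uniq => [|u v]; first exact: filter_uniq.
  rewrite !mem_filter => /andP[Pu uQ] /andP[Pv vQ] e.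
  by have [_ _ <-] := h _ uQ Pu; have [_ _ <-] := h _ vQ Pv; rewrite e.
move=> q; rewrite mem_filter; apply/andP/mapP => [[Pq qQ]|[u + ->]].
  by have [h1 h2 h3] := h' _ qQ Pq; exists (psi q); rewrite ?mem_filter ?h2.
by rewrite mem_filter => /andP[Pu uQ]; have [] := h _ uQ Pu.
Qed.

Definition swapq (q : (nat * nat) * (nat * nat)) := (q.2, q.1).

Lemma swapq_quads n q : (swapq q \in quads n) = (q \in quads n).
Proof.
case: q => [[a x] [b y]]; rewrite !mem_quads [in LHS]addnC.
by do 4!case: (0 < _)%N.
Qed.

Lemma quads_swap (V : nmodType) n (P : pred (nat * nat * (nat * nat)))
    (F : nat * nat * (nat * nat) -> V) :
  \sum_(q <- quads n | P q) F q = \sum_(q <- quads n | P (swapq q)) F (swapq q).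
Proof.
have swK : involutive swapq by case.
apply: (@big_reindex_uniq _ V _ (P \o swapq) P swapq swapq F (quads_uniq n)) => q hq Pq.
  by rewrite swapq_quads swK.
by rewrite swapq_quads /= swK.
Qed.

(* Splitting the quadruples by comparing x with y, resp. a with b, and the
   bijection (a, x, b, y) -> (a - b, x, b, x + y) from {a > b} onto {y > x}. *)
Lemma liouville n (h k : nat -> nat -> rat) :
  (forall a b, h a b = h b a) -> (forall a b, k a b = k b a) ->
  (forall a b, k (a + b)%N b = h a b) ->
  \sum_(q <- quads n) (h q.1.1 q.2.1 - k q.1.1 q.2.1) =
  \sum_(q <- quads n | q.1.2 == q.2.2) h q.1.1 q.2.1
  - \sum_(q <- quads n | q.1.1 == q.2.1) k q.1.1 q.2.1.
Proof.
move=> hs ks kh.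
(* For symmetric F the two off-diagonal halves agree under [swapq]; one is kept, doubled. *)
have split (F : nat -> nat -> rat) (c : (nat * nat) -> nat) : (forall a b, F a b = F b a) ->
  \sum_(q <- quads n) F q.1.1 q.2.1 =
  \sum_(q <- quads n | c q.1 == c q.2) F q.1.1 q.2.1
  + (\sum_(q <- quads n | (c q.1 < c q.2)%N) F q.1.1 q.2.1) *+ 2.
  move=> Fs; rewrite (bigID (fun q => c q.1 == c q.2)); congr (_ + _).
  rewrite (bigID (fun q => (c q.1 < c q.2)%N)) /= mulr2n.
  congr (_ + _); first by apply: eq_bigl => q; case: ltngtP.
  rewrite quads_swap; apply: eq_big => q /=; first by case: ltngtP.
  by rewrite Fs.
rewrite sumrB (split h snd) // (split k fst) //.
have -> : \sum_(q <- quads n | (q.1.2 < q.2.2)%N) h q.1.1 q.2.1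
   = \sum_(q <- quads n | (q.1.1 < q.2.1)%N) k q.1.1 q.2.1.
  rewrite [RHS]quads_swap /=.
  rewrite (@big_reindex_uniq _ _ _ (fun q => q.2.1 < q.1.1)%N _
     (fun q => ((q.1.1 - q.2.1, q.1.2), (q.2.1, q.1.2 + q.2.2)))%N
     (fun q => ((q.1.1 + q.2.1, q.1.2), (q.2.1, q.2.2 - q.1.2)))%N _ (quads_uniq n)).
  - by apply: eq_bigr => q /= ba; rewrite -kh subnK ?(ltnW ba) // ks.
  - case=> [[a x] [b y]] /=; rewrite !mem_quads => /and5P[a0 x0 b0 y0 /eqP e] ba.
    by split; [apply/and5P; split; nia | lia | congr (_, _, (_, _)); lia].
  - case=> [[a x] [b y]] /=; rewrite !mem_quads => /and5P[a0 x0 b0 y0 /eqP e] xy.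
    by split; [apply/and5P; split; nia | lia | congr (_, _, (_, _)); lia].
by ring.
Qed.

(** * Divisor sums and their convolutions *)

Definition sumdiv (f : nat -> rat) : series := fun n =>
  if n == 0%N then 0 else \sum_(d <- divisors n) f d.

Lemma big_divisor_pairs1 (V : nmodType) N n (G : nat -> nat -> V) : (0 < n <= N)%N ->
  \sum_(d <- divisors n) G d (n %/ d)%N =
  \sum_(1 <= d < N.+1) \sum_(1 <= y < N.+1 | (d * y == n)%N) G d y.
Proof.
move=> nN; have /andP[n0 _] := nN; rewrite (big_divisor_pairs _ nN).
apply: eq_bigr => d _; rewrite big_ltn_cond // muln0.
by case: eqP n0 => // <-.
Qed.

Lemma sumdivE N n f : (n <= N)%N ->
  sumdiv f n = \sum_(1 <= a < N.+1) \sum_(1 <= x < N.+1 | (a * x == n)%N) f a.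
Proof.
move=> nN; rewrite /sumdiv; case: posnP => [->|n0]; last first.
  by rewrite -(big_divisor_pairs1 (fun a _ => f a)) // n0.
rewrite big_nat big1 // => a /andP[a0 _]; rewrite big_nat_cond big1 // => x.
by rewrite muln_eq0; case: a x a0 => [|a] [|x]; rewrite // andbF.
Qed.

Lemma big_quads (V : nmodType) n P (F : nat -> nat -> nat -> nat -> V) :
  \sum_(q <- quads n | P q.1.1 q.1.2 q.2.1 q.2.2) F q.1.1 q.1.2 q.2.1 q.2.2 =
  \sum_(1 <= a < n.+1) \sum_(1 <= x < n.+1) \sum_(1 <= b < n.+1) \sum_(1 <= y < n.+1)
    if ((a * x + b * y == n)%N && P a x b y) then F a x b y else 0.
Proof.
rewrite big_filter_cond big_mkcond big_allpairs_dep /pairs big_allpairs_dep.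
apply: eq_bigr => a _; apply: eq_bigr => x _; rewrite big_allpairs_dep.
by [].
Qed.

Lemma sum_indicator n p (c : rat) : (p <= n)%N ->
  \sum_(i < n.+1) (if p == i :> nat then c else 0) = c.
Proof.
move=> pn; rewrite (bigD1 (Ordinal (pn : (p < n.+1)%N))) //= eqxx big1 ?addr0 // => i.
by move/eqP => ip; case: eqP => // e; case: ip; apply: val_inj.
Qed.

Lemma quads_mul n f g :
  \sum_(q <- quads n) f q.1.1 * g q.2.1 = smul (sumdiv f) (sumdiv g) n.
Proof.
rewrite (big_quads n (fun _ _ _ _ => true) (fun a x b y => f a * g b)).
have -> : smul (sumdiv f) (sumdiv g) n =
   \sum_(p < n.+1) \sum_(1 <= a < n.+1) \sum_(1 <= x < n.+1) \sum_(1 <= b < n.+1)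
   \sum_(1 <= y < n.+1) (if (a * x == p)%N && (b * y == n - p)%N then f a * g b else 0).
  apply: eq_bigr => p _; have pn : (p <= n)%N by rewrite -ltnS.
  rewrite (sumdivE f pn) (sumdivE g (leq_subr p n)).
  rewrite mulr_suml; apply: eq_bigr => a _.
  rewrite mulr_suml big_mkcond; apply: eq_bigr => x _; case: eqP => e /=.
    rewrite mulr_sumr; apply: eq_bigr => b _.
    by rewrite mulr_sumr big_mkcond; apply: eq_bigr.
  by rewrite big1 // => b _; rewrite big1.
rewrite [RHS]exchange_big; apply: eq_bigr => a _.
rewrite [RHS]exchange_big; apply: eq_bigr => x _.
rewrite [RHS]exchange_big; apply: eq_bigr => b _.
rewrite [RHS]exchange_big; apply: eq_bigr => y _ /=; rewrite andbT.
case: eqP => e.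
  rewrite -[LHS](@sum_indicator n (a * x)%N); last by rewrite -e leq_addr.
  apply: eq_bigr => p _; case: eqP => //= h; case: eqP => //; lia.
rewrite big1 // => p _; case: eqP => //= h; case: eqP => // h'.
by case: e; have := ltn_ord p; lia.
Qed.

(** Solutions of s(u+v) = n are sorted by d = u+v. With s = x this treats the diagonal x = y, with s
    = a the diagonal a = b. *)
Lemma sum_split_sum n s (H : nat -> nat -> rat) :
  \sum_(1 <= u < n.+1) \sum_(1 <= v < n.+1)
     (if (s * (u + v) == n)%N then H u v else 0) =
  \sum_(1 <= d < n.+1 | (s * d == n)%N) \sum_(1 <= u < d) H u (d - u)%N.
Proof.
have -> : \sum_(1 <= u < n.+1) \sum_(1 <= v < n.+1)
     (if (s * (u + v) == n)%N then H u v else 0)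
 = \sum_(1 <= u < n.+1) \sum_(1 <= d < n.+1)
     (if (s * d == n)%N && (u < d)%N then H u (d - u)%N else 0).
  rewrite big_nat [RHS]big_nat; apply: eq_bigr => u /andP[u0 un].
  rewrite [RHS](big_cat_nat (n := u.+1)) //=.
  rewrite [X in _ = X + _]big_nat [X in _ = X + _]big1 ?add0r => [|d /andP[_ hd]]; last first.
    by rewrite [(u < d)%N]ltnNge -ltnS hd andbF.
  rewrite -[u.+1 in RHS]add1n big_addn (big_cat_nat (n := (n.+1 - u)%N)) //=; [|lia|lia].
  rewrite [X in _ + X]big_nat [X in _ + X]big1 ?addr0 => [|v /andP[v1 v2]]; last first.
    by case: eqP => // e; case: s e => [|s] e; nia.
  rewrite big_nat [RHS]big_nat; apply: eq_bigr => v /andP[v0 vn].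
  by rewrite addnC [(u < _)%N](_ : _ = true) ?andbT ?addnK //; lia.
rewrite exchange_big /= [RHS]big_mkcond big_nat [RHS]big_nat; apply: eq_bigr => d /andP[d0 dn].
case: eqP => e; last by rewrite big1.
rewrite (big_cat_nat (n := d)) //=; last by lia.
rewrite [X in _ + X]big_nat [X in _ + X]big1 ?addr0 => [|v /andP[v1 v2]]; last first.
  by rewrite ltnNge v1.
by rewrite big_nat [RHS]big_nat; apply: eq_bigr => u /andP[_ ->].
Qed.

Lemma quads_diag_x n (H : nat -> nat -> rat) : (0 < n)%N ->
  \sum_(q <- quads n | q.1.2 == q.2.2) H q.1.1 q.2.1 =
  \sum_(d <- divisors n) \sum_(1 <= u < d) H u (d - u)%N.
Proof.
move=> n0; rewrite (big_quads n (fun _ x _ y => x == y) (fun a x b y => H a b)).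
rewrite (big_divisor_pairs1 (N := n) (fun d _ => \sum_(1 <= u < d) H u (d - u)%N)) ?n0 ?leqnn //.
under [RHS]eq_bigr do rewrite big_mkcond.
rewrite exchange_big [RHS]exchange_big big_nat [RHS]big_nat /=.
apply: eq_bigr => x hx; rewrite -big_mkcond; under [RHS]eq_bigl do rewrite mulnC.
rewrite -sum_split_sum; apply: eq_bigr => a _; apply: eq_bigr => b _.
rewrite (bigD1_seq x) ?iota_uniq ?mem_index_iota //= eqxx andbT mulnDr.
rewrite big1 ?addr0 => [|y /negPf yx]; last by rewrite [x == y]eq_sym yx andbF.
by rewrite mulnC [(b * x)%N]mulnC.
Qed.

(** On a = b = d the equation reads d(x+y) = n, which leaves n/d - 1 choices of x. *)
Lemma quads_diag_a n (K : nat -> nat -> rat) : (0 < n)%N ->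
  \sum_(q <- quads n | q.1.1 == q.2.1) K q.1.1 q.2.1 =
  \sum_(d <- divisors n) K d d * (n %/ d).-1%:R.
Proof.
move=> n0; rewrite (big_quads n (fun a _ b _ => a == b) (fun a x b y => K a b)).
rewrite (big_divisor_pairs1 (N := n) (fun d y => K d d * y.-1%:R)) ?n0 ?leqnn //.
rewrite big_nat [RHS]big_nat; apply: eq_bigr => a ha.
have -> : \sum_(1 <= y < n.+1 | (a * y == n)%N) K a a * y.-1%:R =
   \sum_(1 <= y < n.+1 | (a * y == n)%N) \sum_(1 <= u < y) K a a.
  by apply: eq_bigr => y _; rewrite sumr_const_nat subn1 mulr_natr.
rewrite -(sum_split_sum n a (fun _ _ => K a a)); apply: eq_bigr => x _.
rewrite (bigD1_seq a) ?iota_uniq ?mem_index_iota //= [X in _ + X]big1 ?addr0.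
  by apply: eq_bigr => y _; rewrite eqxx andbT mulnDr.
by move=> b /negPf ba; rewrite big1 // => y _; rewrite [a == b]eq_sym ba andbF.
Qed.

Definition eis (k : nat) : series := fun n =>
  if n == 0%N then - bern k / (2 * k)%:R else \sum_(d <- divisors n) d%:R ^+ k.-1.

Lemma smul_const (c e : rat) (f g : nat -> rat) n :
  smul (fun n => if n == 0%N then c else sumdiv f n) (fun n => if n == 0%N then e else sumdiv g n) n =
  if n == 0%N then c * e
  else smul (sumdiv f) (sumdiv g) n + c * sumdiv g n + e * sumdiv f n.
Proof.
case: n => [|n]; first by rewrite /smul big_ord1.
rewrite /smul big_ord_recl big_ord_recr /= subnn subn0 /= [in RHS]big_ord_recl [in RHS]big_ord_recr /=.
rewrite subnn /= !subn0 /= mul0r add0r mulr0 addr0.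
rewrite [c * _ + _]addrC -addrA [_ + c * _]addrC addrA [e * _]mulrC; congr (_ + _ + _).
by apply: eq_bigr => i _; rewrite /bump /= add1n !subSS; have := ltn_ord i; rewrite subn_eq0 ltnNge => /negPf ->.
Qed.

(** * Relations between Eisenstein series *)

Lemma eq_smul s s' t t' : s =1 s' -> t =1 t' -> smul s t =1 smul s' t'.
Proof. by move=> es et n; apply: eq_bigr => i _; rewrite es et. Qed.

Lemma eisE k n : eis k n = if n == 0%N then - bern k / (2 * k)%:R else sumdiv (fun d => d%:R ^+ k.-1) n.
Proof. by rewrite /eis /sumdiv; case: eqP. Qed.

Lemma smul_eis k l n : smul (eis k) (eis l) n =
  if n == 0%N then (- bern k / (2 * k)%:R) * (- bern l / (2 * l)%:R)
  else smul (sumdiv (fun d => d%:R ^+ k.-1)) (sumdiv (fun d => d%:R ^+ l.-1)) n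
    + (- bern k / (2 * k)%:R) * eis l n + (- bern l / (2 * l)%:R) * eis k n.
Proof.
rewrite (eq_smul (eisE k) (eisE l)) smul_const; case: eqP => // n0.
by rewrite !eisE; case: eqP n0.
Qed.

Lemma sumr_ge1 (F : nat -> rat) d : (0 < d)%N -> F 0%N = 0 ->
  \sum_(1 <= u < d) F u = \sum_(u < d) F u.
Proof. by move=> d0 F0; rewrite -(big_mkord xpredT F) [RHS]big_ltn // F0 add0r. Qed.

Lemma bern1 : bern 1 = - (1 / 2).
Proof. by have := bern_rec 2; rewrite !big_ord_recr big_ord0 /= bern0 bin0 bin1; lra. Qed.

Lemma bern2468 : [/\ bern 2 = 1 / 6, bern 4 = - (1 / 30), bern 6 = 1 / 42 & bern 8 = - (1 / 30)].
Proof.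
(* [bern] is generalized so that rewriting does not try to compute it. *)
have val (b : nat -> rat) : (forall n, \sum_(j < n) 'C(n, j)%:R * b j = (n == 1%N)%:R) ->
    b 0%N = 1 -> b 1%N = - (1 / 2) -> b 3 = 0 -> b 5 = 0 -> b 7 = 0 ->
    [/\ b 2 = 1 / 6, b 4 = - (1 / 30), b 6 = 1 / 42 & b 8 = - (1 / 30)].
  move=> rec b0 b1 b3 b5 b7.
  have b2 : b 2 = 1 / 6.
    by have := rec 3; rewrite !big_ord_recr big_ord0 /= b0 b1 /binomial /=; lra.
  have b4 : b 4 = - (1 / 30).
    by have := rec 5; rewrite !big_ord_recr big_ord0 /= b0 b1 b2 b3 /binomial /=; lra.
  have b6 : b 6 = 1 / 42.
    have := rec 7; rewrite !big_ord_recr big_ord0 /= b0 b1 b2 b3 b4 b5 /binomial /=; lra.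
  split=> //.
  by have := rec 9; rewrite !big_ord_recr big_ord0 /= b0 b1 b2 b3 b4 b5 b6 b7 /binomial /=; lra.
exact: (val bern bern_rec bern0 bern1 (bern_odd (n := 3) _ _) (bern_odd (n := 5) _ _) (bern_odd (n := 7) _ _)).
Qed.

(** Faulhaber's formula, in which only B_0, B_1 and the even Bernoulli numbers remain. *)
Lemma sum_pow_even m d : (0 < m)%N ->
  (2 * m + 1)%:R * (\sum_(u < d) u%:R ^+ (2 * m)) =
  d%:R ^+ (2 * m + 1) - (2 * m + 1)%:R / 2 * d%:R ^+ (2 * m)
  + \sum_(j < m) 'C(2 * m + 1, 2 * j.+1)%:R * bern (2 * j.+1) * d%:R ^+ (2 * (m - j) - 1) :> rat.
Proof.
move=> m0; rewrite mulr_sumr.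
under eq_bigr do rewrite mulrC.
rewrite addn1 sum_pow big_ord_recr /= (big_even_odd _ (fun j => 'C(_, j)%:R * bern j * _ ^+ (_ - j))).
case: m m0 => [//|m] _.
have -> : \sum_(j < m.+1) 'C((2 * m.+1).+1, (2 * j).+1)%:R * bern (2 * j).+1
      * d%:R ^+ ((2 * m.+1).+1 - (2 * j).+1)
    = (2 * m.+1).+1%:R * - (1 / 2) * d%:R ^+ (2 * m.+1) :> rat.
  rewrite big_ord_recl muln0 bin1 bern1 subn1 big1 ?addr0 // => j _.
  by rewrite bern_odd ?mulr0 ?mul0r // ?lift0; lia.
rewrite big_ord_recl /=.
rewrite muln0 bin0 bern0 subn0 [in RHS]big_ord_recr /=.
have -> : ((2 * m.+1).+1 - 2 * m.+1 = 2 * (m.+1 - m) - 1)%N by lia.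
have -> : \sum_(i < m) 'C((2 * m.+1).+1, 2 * bump 0 i)%:R * bern (2 * bump 0 i) *
     d%:R ^+ ((2 * m.+1).+1 - 2 * bump 0 i) =
  \sum_(i < m) 'C((2 * m.+1).+1, 2 * i.+1)%:R * bern (2 * i.+1) * d%:R ^+ (2 * (m.+1 - i) - 1) :> rat.
  by apply: eq_bigr => i _; rewrite /bump add1n; congr (_ * _ ^+ _); have := ltn_ord i; lia.
rewrite mul1r; set S := \sum_(i < m) _; set Z := _ * bern (2 * m.+1) * _.
by rewrite mulr1n; field.
Qed.

Lemma pow_add_sub m (a b : rat) : (0 < m)%N ->
  (a + b) ^+ (2 * m) - (a - b) ^+ (2 * m) =
  2 * \sum_(j < m) 'C(2 * m, 2 * j + 1)%:R * (a ^+ (2 * (m - j) - 1) * b ^+ (2 * j + 1)).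
Proof.
move=> m0; rewrite !exprDn -sumrB.
have ev i : (-1) ^+ (2 * i) = 1 :> rat by rewrite exprM sqrrN !expr1n.
have e (i : nat) : a ^+ (2 * m - i) * b ^+ i *+ 'C(2 * m, i) - a ^+ (2 * m - i) * (- b) ^+ i *+ 'C(2 * m, i)
   = (1 - (-1) ^+ i) * ('C(2 * m, i)%:R * (a ^+ (2 * m - i) * b ^+ i)).
  by rewrite [(- b) ^+ i]exprNn -mulrnBl -[LHS]mulr_natl; ring.
rewrite (eq_bigr _ (fun i _ => e (nat_of_ord i))) big_ord_recr /= ev subrr mul0r addr0.
rewrite (big_even_odd _ (fun i => (1 - (-1) ^+ i) * ('C(2 * m, i)%:R * (a ^+ (2 * m - i) * b ^+ i)))).
rewrite big1 ?add0r => [|i _]; last by rewrite ev subrr mul0r.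
rewrite mulr_sumr; apply: eq_bigr => i _.
rewrite exprS ev mulr1 opprK addn1; congr (_ * (_ * (_ ^+ _ * _))).
by have := ltn_ord i; lia.
Qed.

(** An instance of [liouville]: the diagonal x = y gives power sums, evaluated by [sum_pow_even],
    the diagonal a = b gives the term with the factor n, and the contributions d^(2m) cancel. *)
Lemma smul_sumdiv_pow m n : (0 < m)%N -> (0 < n)%N ->
  \sum_(j < m) 'C(2 * m, 2 * j + 1)%:R *
     (2 * smul (sumdiv (fun d => d%:R ^+ (2 * (m - j) - 1))) (sumdiv (fun d => d%:R ^+ (2 * j + 1))) n)
  = \sum_(d <- divisors n)
     ((2 * m + 3)%:R / (2 * m + 1)%:R * d%:R ^+ (2 * m + 1)
      + 2 / (2 * m + 1)%:R * (\sum_(j < m) 'C(2 * m + 1, 2 * j.+1)%:R * bern (2 * j.+1) * d%:R ^+ (2 * (m - j) - 1))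
      - 2 * n%:R * d%:R ^+ (2 * m - 1)).
Proof.
move=> m0 n0.
(* (a+b)^(2m) - (a-b)^(2m) consists of products of odd powers; adding a^(2m) + b^(2m) to both terms
   makes k(a+b, b) = h(a, b). *)
pose h a b : rat := (a%:R + b%:R) ^+ (2 * m) + a%:R ^+ (2 * m) + b%:R ^+ (2 * m).
pose k a b : rat := (a%:R - b%:R) ^+ (2 * m) + a%:R ^+ (2 * m) + b%:R ^+ (2 * m).
have evN (c : rat) : (- c) ^+ (2 * m) = c ^+ (2 * m) by rewrite exprM sqrrN -exprM.
have L := @liouville n h k.
have {L} -> : \sum_(j < m) 'C(2 * m, 2 * j + 1)%:R *
     (2 * smul (sumdiv (fun d => d%:R ^+ (2 * (m - j) - 1))) (sumdiv (fun d => d%:R ^+ (2 * j + 1))) n)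
   = \sum_(q <- quads n) (h q.1.1 q.2.1 - k q.1.1 q.2.1).
  transitivity (\sum_(q <- quads n) 2 * \sum_(j < m) 'C(2 * m, 2 * j + 1)%:R * (q.1.1%:R ^+ (2 * (m - j) - 1) * q.2.1%:R ^+ (2 * j + 1)) : rat).
    under [RHS]eq_bigr do rewrite mulr_sumr.
    rewrite exchange_big; apply: eq_bigr => j _.
    rewrite -(quads_mul n (fun d => d%:R ^+ (2 * (m - j) - 1)) (fun d => d%:R ^+ (2 * j + 1))).
    by rewrite !mulr_sumr; apply: eq_bigr => q _; ring.
  by apply: eq_bigr => q _; rewrite -pow_add_sub // /h /k; ring.
rewrite liouville => [|a b|a b|a b].
- rewrite quads_diag_x // quads_diag_a // -sumrB !big_seq; apply: eq_bigr => d dn.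
  have d0 : (0 < d)%N by move: dn; rewrite -dvdn_divisors //; apply: dvdn_gt0.
  have e1 : \sum_(1 <= u < d) h u (d - u)%N = (d%:R - 1) * d%:R ^+ (2 * m) + 2 * \sum_(u < d) u%:R ^+ (2 * m) :> rat.
    have p0 : 0%:R ^+ (2 * m) = 0 :> rat by rewrite expr0n; case: (m) m0.
    rewrite -(sumr_ge1 (F := fun u => u%:R ^+ (2 * m))) //.
    transitivity (\sum_(1 <= u < d) (d%:R ^+ (2 * m) + u%:R ^+ (2 * m) + (d - u)%N%:R ^+ (2 * m)) : rat).
      rewrite big_nat [RHS]big_nat; apply: eq_bigr => u /andP[_ ud].
      by rewrite /h -natrD subnKC // ltnW.
    rewrite !big_split /= [X in _ + _ + X]big_nat_rev /= sumr_const_nat -[_ ^+ _ *+ _]mulr_natl natrB //.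
    rewrite [X in _ + X = _](_ : _ = \sum_(1 <= u < d) u%:R ^+ (2 * m)); first by ring.
    rewrite big_nat [RHS]big_nat; apply: eq_bigr => u /andP[u0 ud].
    by congr (_%:R ^+ _); lia.
  have e2 : k d d * (n %/ d).-1%:R = 2 * n%:R * d%:R ^+ (2 * m - 1) - 2 * d%:R ^+ (2 * m).
    have dvn : (d %| n)%N by rewrite dvdn_divisors.
    have -> : (n %/ d).-1%:R = (n %/ d)%N%:R - 1 :> rat.
      by rewrite -subn1 natrB // divn_gt0 // dvdn_leq.
    have -> : k d d = 2 * d%:R ^+ (2 * m).
      by rewrite /k subrr expr0n (_ : (2 * m == 0)%N = false) ?add0r; [ring | lia].
    have -> : d%:R ^+ (2 * m) = d%:R * d%:R ^+ (2 * m - 1) :> rat.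
      by rewrite -exprS; congr (_ ^+ _); lia.
    have -> : n%:R = (n %/ d)%N%:R * d%:R :> rat by rewrite -natrM divnK.
    by ring.
  rewrite e1 e2.
  have nz : (2 * m + 1)%:R != 0 :> rat by rewrite pnatr_eq0 addn1.
  have -> : \sum_(u < d) u%:R ^+ (2 * m) = ((2 * m + 1)%:R * (\sum_(u < d) u%:R ^+ (2 * m))) / (2 * m + 1)%:R :> rat.
    by rewrite mulrC mulKf.
  rewrite sum_pow_even //; set S := \sum_(j < m) _.
  have -> : (2 * m + 3)%:R = (2 * m + 1)%:R + 2 :> rat by rewrite -natrD -addnA.
  rewrite [d%:R ^+ (2 * m + 1)]exprD expr1.
  move: nz; move: (2 * m + 1)%:R => c nz.
  by field.
- by rewrite /h [a%:R + _]addrC; ring.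
- by rewrite /k -evN opprB; ring.
- by rewrite /h /k natrD addrK; ring.
Qed.

Lemma sumdiv_pos f n : (0 < n)%N -> sumdiv f n = \sum_(d <- divisors n) f d.
Proof. by rewrite /sumdiv; case: n. Qed.

(* The cross terms with the Bernoulli constants cancel the lower-order terms of
   the power sums; the constant coefficient is Euler's identity [bern_euler]. *)
Lemma eisenstein_rel m n : (0 < m)%N ->
  \sum_(j < m) 'C(2 * m, 2 * j + 1)%:R * smul (eis (2 * (m - j))) (eis (2 * j.+1)) n =
  (2 * m + 3)%:R / (2 * (2 * m + 1))%:R * eis (2 * m.+1) n - Dser (eis (2 * m)) n.
Proof.
move=> m0; have nz2 : (2 * m + 1)%:R != 0 :> rat by rewrite pnatr_eq0 addn1.
case: (posnP n) => [->|n0].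
  rewrite /Dser mul0r subr0.
  have chain (x y u v a b c : rat) : x != 0 -> y != 0 -> x * a = u * b -> y * b = v * c ->
      a = u * v * c / (x * y).
    move=> x0 y0 e1 e2; have -> : a = x * a / x by field.
    rewrite e1; have -> : b = y * b / y by field.
    by rewrite e2; field; rewrite x0 y0.
  transitivity (\sum_(j < m) ('C(2 * m.+1, 2 * j.+1)%:R * bern (2 * j.+1) * bern (2 * (m - j))) / (4 * (2 * m + 1)%:R * (2 * m.+1)%:R)).
    apply: eq_bigr => j _; rewrite smul_eis /=.
    have hj := ltn_ord j.
    (* The two absorption identities turn the binomial coefficient divided by the weights 2(m-j) and
       2(j+1) into a multiple of the coefficient in [bern_euler]. *)
    have c1 : (2 * m + 1)%:R * 'C(2 * m, 2 * j + 1)%:R = (2 * (m - j))%:R * 'C(2 * m + 1, 2 * j + 1)%:R :> rat.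
      rewrite -!natrM; congr (_%:R); have := mul_bin_down (2 * m + 1) (2 * j + 1).
      by rewrite addn1 /= => ->; congr muln; lia.
    have c2 : (2 * m.+1)%:R * 'C(2 * m + 1, 2 * j + 1)%:R = (2 * j.+1)%:R * 'C(2 * m.+1, 2 * j.+1)%:R :> rat.
      rewrite -!natrM; congr (_%:R); have := mul_bin_diag (2 * m.+1) (2 * j + 1).
      have -> : ((2 * m.+1).-1 = 2 * m + 1)%N by lia.
      by have -> : ((2 * j + 1).+1 = 2 * j.+1)%N by lia.
    have nz3 : (2 * m.+1)%:R != 0 :> rat by rewrite pnatr_eq0.
    have nz4 : (2 * (m - j))%:R != 0 :> rat by rewrite pnatr_eq0; lia.
    have nz5 : (2 * j.+1)%:R != 0 :> rat by rewrite pnatr_eq0.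
    have -> : 'C(2 * m, 2 * j + 1)%:R = (2 * (m - j))%:R * (2 * j.+1)%:R * 'C(2 * m.+1, 2 * j.+1)%:R / ((2 * m + 1)%:R * (2 * m.+1)%:R) :> rat.
      exact: (chain _ _ _ _ _ _ _ nz2 nz3 c1 c2).
    rewrite ![(2 * (2 * _))%:R]natrM.
    move: nz2 nz3 nz4 nz5; move: (2 * m + 1)%:R (2 * m.+1)%:R (2 * (m - j))%:R (2 * j.+1)%:R 'C(_, _)%:R.
    by move=> x y u v c hx hy hu hv; field; rewrite hx hy hu hv.
  rewrite -mulr_suml bern_euler // /eis /=.
  have nz3 : (2 * m.+1)%:R != 0 :> rat by rewrite pnatr_eq0.
  rewrite [(2 * (2 * m.+1))%:R]natrM [(2 * (2 * m + 1))%:R]natrM.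
  move: nz2 nz3; move: (2 * m + 1)%:R (2 * m.+1)%:R (2 * m + 3)%:R => x y z hx hy.
  by field; rewrite hx hy.
have n0' : (n == 0%N) = false by lia.
pose s k := sumdiv (fun d => d%:R ^+ k) n.
have eisS k : eis k n = s k.-1 by rewrite eisE n0'.
pose X := \sum_(j < m) 'C(2 * m, 2 * j + 1)%:R * (- bern (2 * j.+1) / (2 * (2 * j.+1))%:R * s (2 * (m - j) - 1)%N).
(* Reflecting j to m-1-j exchanges the two Eisenstein factors, so both families of cross terms add
   up to [X]. *)
have XX : X = \sum_(j < m) 'C(2 * m, 2 * j + 1)%:R
    * (- bern (2 * (m - j)) / (2 * (2 * (m - j)))%:R * s (2 * j + 1)%N).
  rewrite /X (reindex_inj rev_ord_inj); apply: eq_bigr => j _ /=.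
  have hj := ltn_ord j.
  have -> : 'C(2 * m, 2 * (m - j.+1) + 1) = 'C(2 * m, 2 * j + 1).
    by rewrite -bin_sub; [congr 'C(_, _); lia | lia].
  have -> : (2 * (m - j.+1).+1 = 2 * (m - j))%N by lia.
  by have -> : (2 * (m - (m - j.+1)) - 1 = 2 * j + 1)%N by lia.
have -> : \sum_(j < m) 'C(2 * m, 2 * j + 1)%:R * smul (eis (2 * (m - j))) (eis (2 * j.+1)) n =
  \sum_(j < m) 'C(2 * m, 2 * j + 1)%:R * smul (sumdiv (fun d => d%:R ^+ (2 * (m - j) - 1))) (sumdiv (fun d => d%:R ^+ (2 * j + 1))) n
  + X + X.
  rewrite {1}XX /X -!big_split; apply: eq_bigr => j _ /=.
  rewrite smul_eis n0' !eisS; have hj := ltn_ord j.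
  have -> : ((2 * (m - j)).-1 = 2 * (m - j) - 1)%N by lia.
  have -> : ((2 * j.+1).-1 = 2 * j + 1)%N by lia.
  by rewrite /s; ring.
pose Y := \sum_(j < m) 'C(2 * m + 1, 2 * j.+1)%:R * bern (2 * j.+1) * s (2 * (m - j) - 1)%N.
have XY : X = - Y / (2 * (2 * m + 1)%:R).
  rewrite /Y -sumrN mulr_suml; apply: eq_bigr => j _.
  have c : (2 * m + 1)%:R * 'C(2 * m, 2 * j + 1)%:R = (2 * j.+1)%:R * 'C(2 * m + 1, 2 * j.+1)%:R :> rat.
    rewrite -!natrM; congr (_%:R); have := mul_bin_diag (2 * m + 1) (2 * j + 1).
    have -> : ((2 * m + 1).-1 = 2 * m)%N by lia.
    by have -> : ((2 * j + 1).+1 = 2 * j.+1)%N by lia.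
  have nz5 : (2 * j.+1)%:R != 0 :> rat by rewrite pnatr_eq0.
  have -> : 'C(2 * m, 2 * j + 1)%:R = (2 * j.+1)%:R * 'C(2 * m + 1, 2 * j.+1)%:R / (2 * m + 1)%:R :> rat.
    by rewrite -c mulrC mulKf.
  rewrite [(2 * (2 * _))%:R]natrM.
  clear c; move: nz2 nz5; move: (2 * m + 1)%:R (2 * j.+1)%:R 'C(_, _)%:R => x y w hx hy.
  by field; rewrite hx hy.
have := smul_sumdiv_pow m0 n0; rewrite sumrB big_split /= -!mulr_sumr exchange_big /=.
under [X in _ = _ + _ * X - _ -> _]eq_bigr do rewrite -mulr_sumr -sumdiv_pos //.
rewrite -!sumdiv_pos // -/Y -/(s (2 * m + 1)%N) -/(s (2 * m - 1)%N).
under eq_bigr do rewrite mulrCA.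
rewrite -mulr_sumr; set K := \sum_(j < m) _ => key.
rewrite !eisS XY /Dser eisS (_ : (2 * m.+1).-1 = 2 * m + 1)%N; last by lia.
rewrite (_ : (2 * m).-1 = 2 * m - 1)%N; last by lia.
have -> : K = (2 * K) / 2 by field.
rewrite key natrM; move: nz2; move: (2 * m + 1)%:R (2 * m + 3)%:R => x z hx.
by field.
Qed.

(** An elementary substitute for the one-dimensionality of modular forms of weight 8: with h = a^2
    b^2 (a+b)^2 and k = a^2 b^2 (a-b)^2 one has h - k = 4 a^3 b^3, and k vanishes for a = b. *)
Lemma eisenstein_8 n : eis 8 n = 120 * smul (eis 4) (eis 4) n.
Proof.
rewrite smul_eis; case: (posnP n) => [->|n0]; first by case: bern2468 => _ b4 _ b8; rewrite /eis /= b4 b8; lra.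
have n0' : (n == 0%N) = false by lia.
pose h a b : rat := a%:R ^+ 2 * b%:R ^+ 2 * (a%:R + b%:R) ^+ 2.
pose k a b : rat := a%:R ^+ 2 * b%:R ^+ 2 * (a%:R - b%:R) ^+ 2.
have : \sum_(q <- quads n) (h q.1.1 q.2.1 - k q.1.1 q.2.1) =
  4 * smul (sumdiv (fun d => d%:R ^+ 3)) (sumdiv (fun d => d%:R ^+ 3)) n.
  rewrite -quads_mul mulr_sumr; apply: eq_bigr => q _; rewrite /h /k; ring.
rewrite liouville => [|a b|a b|a b]; last first.
- by rewrite /h /k natrD addrK; ring.
- by rewrite /k; ring.
- by rewrite /h; ring.
rewrite quads_diag_x // quads_diag_a // /h /k.
rewrite [X in _ - X]big1 ?subr0 => [|d _]; last by rewrite subrr expr0n mulr0 mul0r.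
have pos_pow d : \sum_(1 <= u < d) u%:R ^+ 2 * (d - u)%N%:R ^+ 2 * (u%:R + (d - u)%N%:R) ^+ 2 = (d%:R ^+ 7 - d%:R ^+ 3) / 30 :> rat.
  (* [c] is kept apart from the summation bound [e] so that induction on [e] applies; both become d
     afterwards. *)
  have S e c : \sum_(u < e) (u%:R : rat) ^+ 2 * (c - u%:R) ^+ 2 =
    c ^+ 2 * (e%:R * (e%:R - 1) * (2 * e%:R - 1) / 6) - 2 * c * (e%:R * (e%:R - 1) / 2) ^+ 2
     + e%:R * (e%:R - 1) * (2 * e%:R - 1) * (3 * e%:R ^+ 2 - 3 * e%:R - 1) / 30.
    elim: e => [|e IH]; first by rewrite big_ord0; ring.
    by rewrite big_ord_recr /= IH -[e.+1%:R]natr1; field.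
  case: d => [|d]; first by rewrite big_geq //; ring.
  transitivity (d.+1%:R ^+ 2 * \sum_(u < d.+1) (u%:R : rat) ^+ 2 * (d.+1%:R - u%:R) ^+ 2).
    rewrite -(sumr_ge1 (F := fun u => (u%:R : rat) ^+ 2 * (d.+1%:R - u%:R) ^+ 2)) //; last by ring.
    rewrite mulr_sumr big_nat [RHS]big_nat; apply: eq_bigr => u /andP[_ ud].
    by rewrite natrB 1?ltnW //; ring.
  by rewrite S; field.
under eq_bigr do rewrite pos_pow.
rewrite -mulr_suml sumrB -!sumdiv_pos // !eisE n0' /= => e.
by case: bern2468 => _ -> _ _; lra.
Qed.

(** * Derivations of Q[G_2, G_4, G_6] *)

(** [eval_qm] truncates at a different order for each coefficient; a common order N makes evaluation
    a ring morphism. *)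
Definition eval_trunc (N : nat) (P : {mpoly rat[3]}) : {poly rat} :=
  mmap (@polyC rat) (fun j => trunc N (Gser j)) P.

Lemma eval_qmE P n : eval_qm P n = (eval_trunc n P)`_n. Proof. by []. Qed.

Lemma eqX_prod N (I : Type) (r : seq I) (P : pred I) F G :
  (forall i, P i -> eqX N (F i) (G i)) ->
  eqX N (\prod_(i <- r | P i) F i) (\prod_(i <- r | P i) G i).
Proof.
move=> h; elim/big_rec2: _ => [|i p q /h hi hpq]; first exact: eqX_refl.
exact: eqXM.
Qed.

Lemma eqX_exp N p q k : eqX N p q -> eqX N (p ^+ k) (q ^+ k).
Proof.
move=> h; elim: k => [|k IH]; first exact: eqX_refl.
by rewrite !exprS; exact: eqXM.
Qed.

Lemma eval_trunc_le N M P : (N <= M)%N -> eqX N (eval_trunc N P) (eval_trunc M P).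
Proof.
move=> NM; apply: eqX_sum => m _; apply: eqXMl; apply: eqX_prod => i _.
apply: eqX_exp; apply/eqX_coefP => k kN.
by rewrite !coef_trunc // (leq_trans kN).
Qed.

Lemma eval_qm_trunc N P n : (n <= N)%N -> eval_qm P n = (eval_trunc N P)`_n.
Proof. by move=> nN; rewrite eval_qmE; have /eqX_coefP -> := eval_trunc_le P nN. Qed.

Lemma eval_qmD P Q n : eval_qm (P + Q) n = eval_qm P n + eval_qm Q n.
Proof. by rewrite !eval_qmE /eval_trunc mmapD coefD. Qed.

Lemma eval_qmZ c P n : eval_qm (c *: P) n = c * eval_qm P n.
Proof. by rewrite !eval_qmE /eval_trunc mmapZ coefCM. Qed.

Lemma eval_qm0 n : eval_qm 0 n = 0.
Proof. by rewrite !eval_qmE /eval_trunc mmap0 coef0. Qed.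

Lemma eval_qm_sum (I : Type) (r : seq I) (P : pred I) F n :
  eval_qm (\sum_(i <- r | P i) F i) n = \sum_(i <- r | P i) eval_qm (F i) n.
Proof. by apply: (big_morph (fun p => eval_qm p n)) => [p q|]; [exact: eval_qmD | exact: eval_qm0]. Qed.

Lemma eval_qmM P Q : eval_qm (P * Q) =1 smul (eval_qm P) (eval_qm Q).
Proof.
move=> n; rewrite eval_qmE /eval_trunc rmorphM coefM; apply: eq_bigr => i _.
by rewrite (@eval_qm_trunc n P) ?(@eval_qm_trunc n Q) ?leq_subr // -ltnS.
Qed.

Lemma eval_qm1 : eval_qm 1 =1 one_series.
Proof. by move=> n; rewrite eval_qmE /eval_trunc rmorph1 coef1. Qed.

Lemma Gser_eis j : Gser j =1 eis (2 * j.+1).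
Proof.
move=> n; rewrite /Gser /eis; case: ifP => // _.
by rewrite natr_sum; apply: eq_bigr => d _; rewrite natrX.
Qed.

Lemma eval_qmX j : eval_qm 'X_j =1 Gser j.
Proof. by move=> n; rewrite eval_qmE /eval_trunc mmapX mmap1U coef_trunc. Qed.

Lemma smulC s t : smul s t =1 smul t s.
Proof.
move=> n; rewrite /smul (reindex_inj rev_ord_inj); apply: eq_bigr => i _ /=.
by rewrite subSS subKn; [rewrite mulrC | rewrite -ltnS].
Qed.

Lemma Dser_smul s t n : Dser (smul s t) n = smul (Dser s) t n + smul s (Dser t) n.
Proof.
rewrite /Dser mulr_sumr -big_split; apply: eq_bigr => i _ /=.
have -> : n%:R = i%:R + (n - i)%N%:R :> rat by rewrite -natrD subnKC // -ltnS.
by ring.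
Qed.

(** The derivation sending ['X_j] to [R j]; D, W and d on polynomials all have this form. *)
Definition mder (R : 'I_3 -> {mpoly rat[3]}) (P : {mpoly rat[3]}) : {mpoly rat[3]} :=
  \sum_(j < 3) R j * mderiv j P.

Lemma mder0 R : mder R 0 = 0.
Proof. by rewrite /mder big1 // => j _; rewrite mderiv0 mulr0. Qed.

Lemma mderD R P Q : mder R (P + Q) = mder R P + mder R Q.
Proof. by rewrite -big_split; apply: eq_bigr => j _; rewrite mderivD mulrDr. Qed.

Lemma mderZ R c P : mder R (c *: P) = c *: mder R P.
Proof. by rewrite scaler_sumr; apply: eq_bigr => j _; rewrite mderivZ scalerAr. Qed.

Lemma mderB R P Q : mder R (P - Q) = mder R P - mder R Q.
Proof. by rewrite -scaleN1r mderD mderZ scaleN1r. Qed.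

Lemma mder_sum R (I : Type) (r : seq I) (Q : pred I) F :
  mder R (\sum_(i <- r | Q i) F i) = \sum_(i <- r | Q i) mder R (F i).
Proof. by apply: (big_morph (mder R)); [exact: mderD | exact: mder0]. Qed.

Lemma mderM R P Q : mder R (P * Q) = mder R P * Q + P * mder R Q.
Proof.
rewrite /mder mulr_suml mulr_sumr -big_split; apply: eq_bigr => j _ /=.
by rewrite mderivM; ring.
Qed.

Lemma mderC R c : mder R c%:MP = 0.
Proof. by rewrite /mder big1 // => j _; rewrite mderivC mulr0. Qed.

Lemma mder1 R : mder R 1 = 0.
Proof. exact: mderC. Qed.

Lemma mderivU (i j : 'I_3) : mderiv i ('X_j : {mpoly rat[3]}) = (i == j)%:R.
Proof.
rewrite mderivX mnm1E eq_sym; case: eqP => [->|_]; last by rewrite scale0r.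
by rewrite -{1}[U_(j)%MM]add0m addmK mpolyX0 scale1r.
Qed.

Lemma mderX R j : mder R 'X_j = R j.
Proof.
rewrite /mder (bigD1 j) //= mderivU eqxx mulr1 big1 ?addr0 // => i /negPf ij.
by rewrite mderivU ij mulr0.
Qed.

(** Partial derivatives commute, so the second-order terms cancel and the commutator is determined
    by its values on the variables. *)
Lemma mder_comm R S P :
  mder R (mder S P) - mder S (mder R P) = mder (fun j => mder R (S j) - mder S (R j)) P.
Proof.
have aux R1 S1 : mder R1 (mder S1 P) =
   mder (fun j => mder R1 (S1 j)) P + \sum_(i < 3) \sum_(j < 3) R1 i * S1 j * mderiv i (mderiv j P).
  rewrite {2}/mder mder_sum.
  under eq_bigr do rewrite mderM.
  rewrite big_split /=; congr (_ + _).
  under eq_bigr do rewrite mulr_sumr.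
  rewrite exchange_big; apply: eq_bigr => i _; apply: eq_bigr => j _; ring.
rewrite !aux [X in _ - (_ + X)](_ : _ = \sum_(i < 3) \sum_(j < 3) R i * S j * mderiv i (mderiv j P)).
  by rewrite opprD addrACA subrr addr0 -sumrB; apply: eq_bigr => j _; rewrite mulrBl.
rewrite exchange_big; apply: eq_bigr => i _; apply: eq_bigr => j _.
by rewrite mderiv_comm; ring.
Qed.

Lemma eq_mder R S P : R =1 S -> mder R P = mder S P.
Proof. by move=> e; apply: eq_bigr => j _; rewrite e. Qed.

Lemma eval_mder R : (forall j, eval_qm (R j) =1 Dser (Gser j)) ->
  forall P, eval_qm (mder R P) =1 Dser (eval_qm P).
Proof.
move=> hR.
pose K P := eval_qm (mder R P) =1 Dser (eval_qm P).
have KD P Q : K P -> K Q -> K (P + Q).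
  by move=> hP hQ n; rewrite mderD eval_qmD hP hQ /Dser eval_qmD mulrDr.
have KZ c P : K P -> K (c *: P).
  by move=> hP n; rewrite mderZ eval_qmZ hP /Dser eval_qmZ mulrCA.
have KM P Q : K P -> K Q -> K (P * Q).
  move=> hP hQ n; rewrite mderM eval_qmD !eval_qmM (eq_smul hP (frefl _)) (eq_smul (frefl _) hQ).
  by rewrite -Dser_smul /Dser eval_qmM.
have K1 : K 1.
  by move=> n; rewrite mder1 eval_qm0 /Dser eval_qm1 /one_series; case: eqP => [->|_]; rewrite ?mul0r ?mulr0.
have KX j : K 'X_j by move=> n; rewrite mderX hR /Dser eval_qmX.
have KE P k : K P -> K (P ^+ k).
  by move=> hP; elim: k => [|k IH]; rewrite ?expr0 // exprS; apply: KM.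
elim/mpolyind => [|c m p _ _ hp]; first by move=> n; rewrite mder0 /Dser eval_qm0 mulr0.
apply: KD hp; apply: KZ; rewrite mpolyXE_id.
by elim/big_rec: _ => [|i p' _ hp']; [exact: K1 | apply: KM => //; apply: KE].
Qed.

(** * Ramanujan's differential equations *)

Definition o0 : 'I_3 := 0.
Definition o1 : 'I_3 := @Ordinal 3 1 isT.
Definition o2 : 'I_3 := @Ordinal 3 2 isT.

Lemma ord3P (Q : 'I_3 -> Prop) : Q o0 -> Q o1 -> Q o2 -> forall j, Q j.
Proof.
move=> h0 h1 h2 [[|[|[|//]]] hj].
- by rewrite (_ : Ordinal hj = o0) //; apply: val_inj.
- by rewrite (_ : Ordinal hj = o1) //; apply: val_inj.
- by rewrite (_ : Ordinal hj = o2) //; apply: val_inj.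
Qed.

(* [ramanujan j] is the q d/dq-derivative of G_(2j+2). *)
Definition ramanujan (j : 'I_3) : {mpoly rat[3]} :=
  match val j with
  | 0 => (5 / 6) *: 'X_o1 - 2 *: 'X_o0 ^+ 2
  | 1 => (7 / 10) *: 'X_o2 - 8 *: ('X_o0 * 'X_o1)
  | _ => (400 / 7) *: 'X_o1 ^+ 2 - 12 *: ('X_o0 * 'X_o2)
  end.

Definition Dqm := mder ramanujan.

Lemma eval_qmB P Q n : eval_qm (P - Q) n = eval_qm P n - eval_qm Q n.
Proof. by rewrite -scaleN1r eval_qmD eval_qmZ mulN1r. Qed.

Lemma eval_qmXM i j n : eval_qm ('X_i * 'X_j) n = smul (eis (2 * i.+1)) (eis (2 * j.+1)) n.
Proof.
rewrite eval_qmM; apply: eq_smul => k; rewrite eval_qmX; exact: Gser_eis.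
Qed.

(** The cases m = 1, 2, 3 of [eisenstein_rel]. In the third, G_8 = 120 G_4^2 turns the coefficient
    of G_4^2 into 120 * 9/14 - 20 = 400/7. *)
Lemma eval_ramanujan j : eval_qm (ramanujan j) =1 Dser (Gser j).
Proof.
have DE i n : Dser (Gser i) n = Dser (eis (2 * i.+1)) n by rewrite /Dser Gser_eis.
move: j; apply: ord3P => n; rewrite DE /ramanujan /= eval_qmB !eval_qmZ ?expr2 !eval_qmXM ?eval_qmX ?Gser_eis.
- have := @eisenstein_rel 1 n isT; rewrite big_ord_recr big_ord0 /= /binomial /= => e.
  have {}e : 0 + 2 * smul (eis 2) (eis 2) n = 5 / 6 * eis 4 n - Dser (eis 2) n := e.
  suff: 5 / 6 * eis 4 n - 2 * smul (eis 2) (eis 2) n = Dser (eis 2) n by [].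
  lra.
- have := @eisenstein_rel 2 n isT; rewrite !big_ord_recr big_ord0 /= /binomial /= => e.
  have {}e : 0 + 4 * smul (eis 4) (eis 2) n + 4 * smul (eis 2) (eis 4) n
     = 7 / 10 * eis 6 n - Dser (eis 4) n := e.
  suff: 7 / 10 * eis 6 n - 8 * smul (eis 2) (eis 4) n = Dser (eis 4) n by [].
  rewrite [smul (eis 4) _ _]smulC in e; lra.
- have := @eisenstein_rel 3 n isT; rewrite !big_ord_recr big_ord0 /= /binomial /= => e.
  have {}e : 0 + 6 * smul (eis 6) (eis 2) n + 20 * smul (eis 4) (eis 4) n + 6 * smul (eis 2) (eis 6) n
     = 9 / 14 * eis 8 n - Dser (eis 6) n := e.
  suff: 400 / 7 * smul (eis 4) (eis 4) n - 12 * smul (eis 2) (eis 6) n = Dser (eis 6) n by [].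
  rewrite [smul (eis 6) _ _]smulC eisenstein_8 in e; lra.
Qed.

Lemma eval_Dqm P : eval_qm (Dqm P) =1 Dser (eval_qm P).
Proof. exact: eval_mder eval_ramanujan _. Qed.

Lemma WqmE P : Wqm P = mder (fun j => (2 * j.+1)%:R *: 'X_j) P.
Proof. by apply: eq_bigr => j _; rewrite scalerAl. Qed.

Lemma dqmE P : dqm P = mder (fun j => if j == 0 then (- (1 / 2))%:MP else 0) P.
Proof.
rewrite /mder (bigD1 0) //= big1 ?addr0 ?mul_mpolyC // => j /negPf ->.
by rewrite mul0r.
Qed.

Lemma mder_ramanujan R :
  [/\ mder R (ramanujan o0) = (5 / 6) *: R o1 - 2 *: (R o0 * 'X_o0 + 'X_o0 * R o0),
      mder R (ramanujan o1) = (7 / 10) *: R o2 - 8 *: (R o0 * 'X_o1 + 'X_o0 * R o1) &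
      mder R (ramanujan o2) = (400 / 7) *: (R o1 * 'X_o1 + 'X_o1 * R o1)
                              - 12 *: (R o0 * 'X_o2 + 'X_o0 * R o2)].
Proof. by split; rewrite /ramanujan /= mderB !mderZ ?expr2 ?mderM !mderX. Qed.

(** Each [ramanujan j] is homogeneous, of weight two more than ['X_j]. *)
Lemma Wqm_Dqm P : Wqm (Dqm P) - Dqm (Wqm P) = 2 *: Dqm P.
Proof.
rewrite !WqmE mder_comm (eq_mder (S := fun j => 2 *: ramanujan j)).
  by rewrite [RHS]scaler_sumr; apply: eq_bigr => j _; rewrite scalerAl.
have [e0 e1 e2] := mder_ramanujan (fun j => (2 * j.+1)%:R *: 'X_j).
apply: ord3P; rewrite mderZ mderX ?e0 ?e1 ?e2 /ramanujan /=.
- move: (5 / 6) => a; rewrite !scaler_nat -!mul_mpolyC; ring.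
- move: (7 / 10) => a; rewrite !scaler_nat -!mul_mpolyC; ring.
- move: (400 / 7) => a; rewrite !scaler_nat -!mul_mpolyC; ring.
Qed.

(** Multiplying the G_2-derivatives of -2 G_2^2, -8 G_2 G_4 and -12 G_2 G_6 by -1/2 gives 2 G_2, 4
    G_4 and 6 G_6, which are the values of W on the variables. *)
Lemma dqm_Dqm P : dqm (Dqm P) - Dqm (dqm P) = Wqm P.
Proof.
rewrite !dqmE mder_comm WqmE; apply: eq_mder.
have [e0 e1 e2] := mder_ramanujan (fun j => if j == 0 then (- (1 / 2))%:MP else 0).
apply: ord3P; rewrite /= ?mderC ?mder0 ?e0 ?e1 ?e2 /=.
all: rewrite ?mulr0 ?mul0r ?scaler0 ?addr0 ?scaler0 ?sub0r ?subr0 ?[_ * _%:MP]mulrC.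
all: rewrite mul_mpolyC -?scalerDl scalerA -scaleNr; congr (_ *: _).
all: rewrite ?natrM; lra.
Qed.

(** * All Eisenstein series as polynomials in G_2, G_4, G_6 *)

(** Entry j of [s] stands for G_(2j+2). From m = 3 on this is [eisenstein_rel] solved for G_(2m+2);
    carrying the list of all earlier values makes the recursion structural. *)
Definition eis_step (m : nat) (s : seq {mpoly rat[3]}) : {mpoly rat[3]} :=
  match m with
  | 0 => 'X_o0
  | 1 => 'X_o1
  | 2 => 'X_o2
  | _ => ((2 * (2 * m + 1))%:R / (2 * m + 3)%:R) *:
         (\sum_(j < m) 'C(2 * m, 2 * j + 1)%:R *: (s`_(m - j.+1) * s`_j) + Dqm s`_m.-1)
  end.

Fixpoint eisl (n : nat) : seq {mpoly rat[3]} :=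
  if n is n'.+1 then rcons (eisl n') (eis_step n' (eisl n')) else [::].

Definition eisp (m : nat) : {mpoly rat[3]} := eis_step m (eisl m).

Lemma size_eisl n : size (eisl n) = n.
Proof. by elim: n => //= n IH; rewrite size_rcons IH. Qed.

Lemma nth_eisl n i : (i < n)%N -> (eisl n)`_i = eisp i.
Proof.
elim: n => // n IH; rewrite ltnS leq_eqVlt => /orP[/eqP ->|iN].
  by rewrite /= nth_rcons size_eisl ltnn eqxx.
by rewrite /= nth_rcons size_eisl iN IH.
Qed.

Lemma eispE m : (2 < m)%N -> eisp m = ((2 * (2 * m + 1))%:R / (2 * m + 3)%:R) *:
  (\sum_(j < m) 'C(2 * m, 2 * j + 1)%:R *: (eisp (m - j.+1) * eisp j) + Dqm (eisp m.-1)).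
Proof.
case: m => [|[|[|m]]] // _; rewrite {1}/eisp /eis_step.
rewrite nth_eisl //; congr (_ *: (_ + _)); apply: eq_bigr => j _.
by rewrite !nth_eisl ?ltn_ord // subSS ltnS leq_subr.
Qed.

Lemma DqmZ c P : Dqm (c *: P) = c *: Dqm P. Proof. exact: mderZ. Qed.
Lemma DqmC c : Dqm c%:MP = 0. Proof. exact: mderC. Qed.

(** The three claims need each other in the induction. For d, the two products in the recurrence
    that contain G_2 contribute -m G_(2m) each, while d D G_(2m) = W G_(2m) = 2m G_(2m), as D kills
    the constant d G_(2m). *)
Lemma eisp_spec m : [/\ eval_qm (eisp m) =1 eis (2 * m.+1),
  Wqm (eisp m) = (2 * m.+1)%:R *: eisp m &
  dqm (eisp m) = (if m == 0%N then - (1 / 2) else 0)%:MP].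
Proof.
elim/ltn_ind: m => m IH; case: (ltnP 2 m) => m2; last first.
  case: m m2 {IH} => [|[|[|m]]] // _; rewrite WqmE dqmE !mderX; split=> //;
    by move=> n; rewrite eval_qmX Gser_eis.
have E1 j : (j < m)%N -> eval_qm (eisp j) =1 eis (2 * j.+1) by move=> /IH[].
have E2 j : (j < m)%N -> Wqm (eisp j) = (2 * j.+1)%:R *: eisp j by move=> /IH[].
have E3 j : (j < m)%N -> dqm (eisp j) = (if j == 0%N then - (1 / 2) else 0)%:MP by move=> /IH[].
have nz1 : (2 * m + 1)%:R != 0 :> rat by rewrite pnatr_eq0 addn1.
have nz3 : (2 * m + 3)%:R != 0 :> rat by rewrite pnatr_eq0 addnS.
have m1 : (m.-1 < m)%N by lia.
have m1S : m.-1.+1 = m by lia.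
rewrite (eispE m2); split.
- move=> n; rewrite eval_qmZ eval_qmD eval_qm_sum eval_Dqm.
  under eq_bigr => j _.
    rewrite eval_qmZ eval_qmM.
    rewrite (eq_smul (E1 (m - j.+1)%N _) (E1 j (ltn_ord j))) ?(subnSK (ltn_ord j)); last by have := ltn_ord j; lia.
    over.
  have m0 : (0 < m)%N by lia.
  rewrite /= eisenstein_rel // /Dser (E1 _ m1) m1S subrK natrM.
  by move: nz1 nz3; move: (2 * m + 1)%:R (2 * m + 3)%:R => x y hx hy; field; rewrite hx hy.
- move: (_ / _) => c; rewrite WqmE mderZ [RHS]scalerA [_ * c]mulrC -scalerA; congr (_ *: _).
  rewrite mderD -!WqmE scalerDr; congr (_ + _).
    rewrite WqmE mder_sum scaler_sumr; apply: eq_bigr => j _; have hj := ltn_ord j.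
    rewrite mderZ mderM -!WqmE !E2 //; last by lia.
    rewrite -scalerAl -scalerAr -scalerDl !scalerA mulrC; congr (_ * _ *: _).
    by rewrite -natrD; congr (_%:R); lia.
  have := Wqm_Dqm (eisp m.-1); rewrite E2 // DqmZ => /eqP; rewrite subr_eq => /eqP ->.
  by rewrite -scalerDl -natrD m1S; congr (_%:R *: _); lia.
- have -> : (m == 0%N) = false by lia.
  rewrite dqmE mderZ mderD -!dqmE mpolyC0.
  rewrite [X in _ *: X](_ : _ = 0) ?scaler0 //.
  have := dqm_Dqm (eisp m.-1); rewrite E3 // E2 // DqmC subr0 m1S => ->.
  rewrite dqmE mder_sum.
  rewrite (eq_bigr (fun j : 'I_m => 'C(2 * m, 2 * j + 1)%:R *:
     ((if (m - j.+1 == 0)%N then - (1 / 2) else 0) *: eisp j)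
     + 'C(2 * m, 2 * j + 1)%:R *:
     ((if (j == 0 :> nat)%N then - (1 / 2) else 0) *: eisp (m - j.+1)))); last first.
    move=> j _; have hj := ltn_ord j; rewrite mderZ mderM -!dqmE !E3 //; last by lia.
    by rewrite [_ * _%:MP]mulrC !mul_mpolyC scalerDr.
  (* Only the last term of the first sum and the first term of the second contain the derivative of
     G_2. *)
  rewrite big_split /= -m1S big_ord_recr [X in _ + X + _]big_ord_recl /= subnn.
  rewrite !big1 => [|j _|j _]; last first.
  + by rewrite (_ : (_ == _) = false) ?scale0r ?scaler0 //; have := ltn_ord j; lia.
  + by rewrite /= scale0r scaler0.
  rewrite subn1 addr0 add0r /= !scalerA -!scalerDl muln0 bin1.
  rewrite (_ : 'C(_, _) = 2 * m.-1.+1)%N; last first.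
    by rewrite -[RHS]bin1 -bin_sub; [congr 'C(_, _); lia | lia].
  by rewrite [X in X *: _](_ : _ = 0) ?scale0r //; lra.
Qed.

(** * Equivariance *)

Lemma Wqm_iter a w Q : Wqm Q = w%:R *: Q ->
  Wqm (iter a Dqm Q) = (w + 2 * a)%:R *: iter a Dqm Q.
Proof.
move=> hQ; elim: a => [|a IH]; first by rewrite muln0 addn0.
have := Wqm_Dqm (iter a Dqm Q); rewrite IH DqmZ => /eqP; rewrite subr_eq => /eqP /= ->.
by rewrite -scalerDl -natrD; congr (_%:R *: _); lia.
Qed.

(** The lowering formula for a lowest weight vector: the weights w + 2i, for i from 0 to a, add up
    to (a+1)(w+a). The constant [c] disappears under D. *)
Lemma dqm_iter a w c Q : Wqm Q = w%:R *: Q -> dqm Q = c%:MP ->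
  dqm (iter a.+1 Dqm Q) = (a.+1 * (w + a))%:R *: iter a Dqm Q.
Proof.
move=> hW hd; have step P := dqm_Dqm P.
elim: a => [|a IH] /=.
  by have := step Q; rewrite hd DqmC subr0 hW addn0 mul1n.
have := step (iter a.+1 Dqm Q).
rewrite IH DqmZ (Wqm_iter _ hW) => /eqP; rewrite subr_eq => /eqP /= ->.
by rewrite -scalerDl -natrD; congr (_%:R *: _); lia.
Qed.

Lemma eval_iter a Q n : eval_qm (iter a Dqm Q) n = n%:R ^+ a * eval_qm Q n.
Proof.
elim: a => [|a IH] /=; first by rewrite expr0 mul1r.
by rewrite eval_Dqm /Dser IH exprS mulrA.
Qed.

(* <T_(k,l)>_q is an iterated derivative of G_(2 halfgap + 2). *)
Definition halfgap (k l : nat) : nat := ((k.+1 - l) + (l - k.+1))./2.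

Definition Tpoly (k l : nat) : {mpoly rat[3]} :=
  iter (minn k l.-1) Dqm (eisp (halfgap k l)).

Lemma big_divisors_compl (V : nmodType) n (F : nat -> nat -> V) : (0 < n)%N ->
  \sum_(d <- divisors n) F d (n %/ d)%N = \sum_(d <- divisors n) F (n %/ d)%N d.
Proof.
move=> n0; have nn : (0 < n <= n)%N by rewrite n0 leqnn.
rewrite (big_divisor_pairs1 F nn) (big_divisor_pairs1 (fun a b => F b a) nn).
under eq_bigr do rewrite big_mkcond; rewrite exchange_big /=.
apply: eq_bigr => d _; rewrite -big_mkcond.
by apply: eq_bigl => e; rewrite mulnC.
Qed.

(** The two truncated differences add up to |k-l+1|, which is odd because k+l is even. *)
Lemma halfgapE k l : (0 < l)%N -> ~~ odd (k + l) ->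
  (2 * (halfgap k l).+1 = ((k.+1 - l) + (l - k.+1)).+1)%N.
Proof.
move=> l0 okl; rewrite /halfgap; set g := (_ + _)%N.
have og : odd g.
  rewrite /g; case: (leqP l k.+1) => h.
    rewrite (eqP (_ : (l - k.+1 == 0)%N)) ?subn_eq0 // addn0.
    by rewrite oddB //=; move: okl; rewrite oddD; case: odd; case: odd.
  rewrite (eqP (_ : (k.+1 - l == 0)%N)) ?subn_eq0 1?ltnW // add0n.
  by rewrite oddB 1?ltnW //=; move: okl; rewrite oddD; case: odd; case: odd.
by have := odd_double_half g; rewrite og -muln2; lia.
Qed.

(** With a the smaller of k and l-1, d^k (n/d)^(l-1) is n^a times the power |k-l+1| of d or of n/d,
    and the factor n^a is a-fold application of D. Complementary divisors reduce the second case to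
    the first. *)
Lemma eval_Tpoly k l : (0 < l)%N -> ~~ odd (k + l) -> eval_qm (Tpoly k l) =1 Tser k l.
Proof.
move=> l0 okl n; rewrite /Tpoly eval_iter.
have [-> _ _] := eisp_spec (halfgap k l); rewrite halfgapE //.
rewrite /eis /Tser; case: (posnP n) => [->|n0] /=.
  (* The constant of T_(k,l) has a nonzero delta factor only for k = 0 or l = 1, exactly when no
     derivative is taken; parity excludes both at once. *)
  case: k okl => [|k] okl.
    rewrite min0n expr0 mul1r /Tconst add0n (_ : (1 - l + (l - 1)).+1 = l)%N; last by lia.
    by rewrite (_ : (l == 1%N) = false) ?mulr1 //; case: l okl {l0} => [|[|]].
  case: l l0 okl => [|[|l]] // _ okl; last by rewrite minnSS expr0n mul0r /Tconst mulr0.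
  rewrite minn0 expr0 mul1r /Tconst addn1 /= mulr1.
  by rewrite (_ : (k.+2 - 1 + (1 - k.+2)).+1 = k.+2)%N //; lia.
case: (leqP l.-1 k) => h.
  rewrite mulr_sumr !big_seq; apply: eq_bigr => d; rewrite -dvdn_divisors // => dn.
  rewrite -{1}(divnK dn) natrM exprMn -mulrA -exprD mulrC; congr (_ ^+ _ * _); lia.
rewrite mulr_sumr (big_divisors_compl (fun a b => a%:R ^+ k * b%:R ^+ l.-1)) //.
rewrite !big_seq; apply: eq_bigr => d; rewrite -dvdn_divisors // => dn.
rewrite -{1}(divnK dn) natrM exprMn -mulrA -exprD; congr (_ * _ ^+ _); lia.
Qed.

(** [lin mon_poly] is the q-bracket lifted to polynomials, with [odot] turned into
    multiplication. *)
Definition mon_poly (m : fmon) : {mpoly rat[3]} := \prod_(x <- m) Tpoly x.1 x.2.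

Lemma has_bracket_ext f s t : s =1 t -> has_bracket f s -> has_bracket f t.
Proof. by move=> e h N; rewrite -(eq_trunc N e). Qed.

Lemma has_bracket_evmon m : validm m -> has_bracket (evmon m) (eval_qm (mon_poly m)).
Proof.
elim: m => [|x m IH] /=.
  move=> _; rewrite /mon_poly big_nil; apply: has_bracket_ext has_bracket_one.
  exact: fsym eval_qm1.
case/andP=> /andP[x2 ox] vm; rewrite /mon_poly big_cons.
apply: has_bracket_ext (has_bracket_odot (has_bracket_Tkl x2 ox) (IH vm)).
by move=> n; rewrite eval_qmM; apply: eq_smul => // k; rewrite eval_Tpoly.
Qed.

Lemma qbracket_ev p : validf p -> qbracket (ev p) =1 eval_qm (lin mon_poly p).
Proof.
move=> vp; apply: has_bracketP.
apply: (@has_bracket_ext _ (fun n => \sum_(t <- p) t.1 * eval_qm (mon_poly t.2) n)).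
  by move=> n; rewrite /lin eval_qm_sum; apply: eq_bigr => t _; rewrite eval_qmZ.
by apply: has_bracket_sum => t tp; apply/has_bracket_evmon/(allP vp _ tp).
Qed.

(** Both sides obey the Leibniz rule along the multiplicative map [mon_poly], so generators
    suffice. *)
Lemma lin_derf_mder R img p :
  (forall x, (0 < x.2)%N -> ~~ odd (x.1 + x.2) ->
     lin mon_poly (img x) = mder R (Tpoly x.1 x.2)) ->
  validf p -> lin mon_poly (derf img p) = mder R (lin mon_poly p).
Proof.
move=> himg vp; rewrite lin_derf /lin mder_sum big_seq [RHS]big_seq.
apply: eq_bigr => t tp; rewrite mderZ; congr (_ *: _).
have : validm t.2 by apply: (allP vp _ tp).
elim: t.2 => [_|x m IH /= /andP[/andP[x2 ox] vm]].
  by rewrite dmon_nil /mon_poly big_nil mder1.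
rewrite dmon_cons /mon_poly big_cons mderM -/(mon_poly m) -himg //; congr (_ + _).
  rewrite /lin mulr_suml; apply: eq_bigr => u _.
  by rewrite /mon_poly big_cat -scalerAl.
rewrite -IH // /dmon mulr_sumr; apply: eq_bigr => i _.
rewrite /lin mulr_sumr; apply: eq_bigr => u _.
by rewrite big_cons scalerAr.
Qed.

Lemma validf_derf img p :
  (forall x, (0 < x.2)%N -> ~~ odd (x.1 + x.2) -> validf (img x)) ->
  validf p -> validf (derf img p).
Proof.
move=> himg vp; apply/allP => s /flattenP[_ /mapP[t tp ->]].
case/flattenP=> _ /mapP[i + ->] /mapP[u ui ->] /=.
rewrite mem_iota add0n => /andP[_ ilt].
have vt := allP vp _ tp; rewrite !all_cat.
have /andP[h1 h2] := allP vt _ (mem_nth (0, 0)%N ilt).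
have -> := allP (himg _ h1 h2) _ ui.
apply/and3P; split=> //; apply/allP => x; first by move/mem_take; apply: (allP vt).
by move/mem_drop; apply: (allP vt).
Qed.

Lemma mon_poly1 x : mon_poly [:: x] = Tpoly x.1 x.2.
Proof. exact: big_seq1. Qed.

(** Raising k and l together keeps |k-l+1| and adds one derivative. *)
Lemma lin_Dop p : validf p -> lin mon_poly (Dop p) = Dqm (lin mon_poly p).
Proof.
apply: lin_derf_mder => -[k [|l]] // _ _; rewrite lin1 mon_poly1 scale1r.
by rewrite /Tpoly /= minnSS /halfgap !subSS.
Qed.

Lemma Wqm_Tpoly k l : (0 < l)%N -> ~~ odd (k + l) ->
  Wqm (Tpoly k l) = (k + l)%:R *: Tpoly k l.
Proof.
move=> l0 okl; have [_ hW _] := eisp_spec (halfgap k l).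
rewrite (Wqm_iter _ hW) halfgapE //; congr (_%:R *: _); lia.
Qed.

Lemma lin_Wop p : validf p -> lin mon_poly (Wop p) = Wqm (lin mon_poly p).
Proof.
rewrite WqmE; apply: lin_derf_mder => -[k l] l0 okl.
by rewrite lin1 mon_poly1 /= -WqmE Wqm_Tpoly.
Qed.

(** If k > 0 and l > 1, [dqm_iter] with a+1 = min(k, l-1) and w = |k-l+1|+1 gives (a+1)(w+a) =
    k(l-1). Otherwise no derivative is taken, and d is nonzero only on G_2, that is for |k-l+1| = 1,
    which then means k+l = 2. *)
Lemma lin_dop p : validf p -> lin mon_poly (dop p) = dqm (lin mon_poly p).
Proof.
rewrite dqmE; apply: lin_derf_mder => -[k l] /= l0 okl; rewrite -dqmE.
have [_ hW hd] := eisp_spec (halfgap k l).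
rewrite /imgd lin_cat /=; case: ifP => kl.
  have -> : (k + l == 2)%N = false by lia.
  have e : (minn k l.-1 = (minn k.-1 l.-2).+1)%N by lia.
  rewrite lin1 /lin big_nil addr0 mon_poly1 {2}/Tpoly e (dqm_iter _ hW hd) /Tpoly /=.
  have -> : halfgap k.-1 l.-1 = halfgap k l by rewrite /halfgap; congr (_./2); lia.
  by rewrite halfgapE //; congr (_%:R *: _); nia.
rewrite /Tpoly (_ : minn k l.-1 = 0)%N; last by lia.
rewrite /= hd {1}/lin big_nil add0r.
have hg := halfgapE l0 okl.
case: eqP => kl2; last by rewrite /lin big_nil ifF ?mpolyC0 //; lia.
by rewrite lin1 /mon_poly big_nil ifT ?alg_mpolyC //; lia.
Qed.

Lemma validf_imgD x : (0 < x.2)%N -> ~~ odd (x.1 + x.2) -> validf (imgD x).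
Proof. by move=> _ ox; rewrite /= ?addnS ?addSn /= ?negbK ?ox. Qed.

Lemma validf_imgW x : (0 < x.2)%N -> ~~ odd (x.1 + x.2) -> validf (imgW x).
Proof. by move=> x2 ox /=; rewrite x2 ox. Qed.

Lemma validf_imgd x : (0 < x.2)%N -> ~~ odd (x.1 + x.2) -> validf (imgd x).
Proof.
case: x => -[|k] [|[|l]] //= _ ox; rewrite /imgd /=; case: ifP => _ //=.
all: by rewrite ?andbT; move: ox; rewrite ?addnS ?addSn /= ?negbK.
Qed.

Theorem theorem5p2p2 :
  (* sl2 relations on T: [W,D] = 2D, [W,d] = -2d, [d,D] = W *)
  (forall (p : felt), validf p -> forall la : intpart,
      [/\ ev (Wop (Dop p)) la - ev (Dop (Wop p)) la = 2 * ev (Dop p) la,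
          ev (Wop (dop p)) la - ev (dop (Wop p)) la = - (2 * ev (dop p) la) &
          ev (dop (Dop p)) la - ev (Dop (dop p)) la = ev (Wop p) la])
  /\
  (* the q-bracket T -> M~ is sl2-equivariant *)
  (forall (p : felt), validf p ->
     exists P : {mpoly rat[3]},
       [/\ qbracket (ev p) =1 eval_qm P,
           qbracket (ev (Dop p)) =1 Dser (qbracket (ev p)),
           qbracket (ev (Wop p)) =1 eval_qm (Wqm P) &
           qbracket (ev (dop p)) =1 eval_qm (dqm P)]).
Proof.
split=> p vp => [la|].
  have [hWD hWd hdD] := sl2_formal (evmon^~ la) vp.
  by rewrite !ev_lin hWD hWd hdD -mulNr scale1r.
(* The witness is the lifted bracket of [p], on which W and d have just been computed. *)
exists (lin mon_poly p); split=> n.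
- by rewrite qbracket_ev.
- rewrite qbracket_ev; last exact: validf_derf validf_imgD vp.
  by rewrite lin_Dop // eval_Dqm /Dser qbracket_ev.
- by rewrite qbracket_ev ?lin_Wop //; exact: validf_derf validf_imgW vp.
- by rewrite qbracket_ev ?lin_dop //; exact: validf_derf validf_imgd vp.
Qed.
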